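(* Let $f(z)=z+a_2z^2+\cdots$ belong to $\mathcal{U}$ with $a_2\neq 0$, and define $$g(z)=\frac{z/f(z)-1}{-a_2}.$$ Then: (a) $|g'(z)-1|<1$ for $|z|<|a_2|/2$; (b) $\left|\frac{zg'(z)}{g(z)}-1\right|<1$ for $|z|<|a_2|/2$; in particular $g$ is starlike in the disc $|z|<|a_2|/2$, i.e. $\operatorname{Re}\frac{zg'(z)}{g(z)}>0$ there; (c) if $0<|a_2|\le 1$, then $g$ belongs to $\mathcal{U}$ in the disc $|z|<|a_2|/2$, i.e. $\left|\left[\frac{z}{g(z)}\right]^2g'(z)-1\right|<1$ for $|z|<|a_2|/2$. The results are best possible (the radius $|a_2|/2$ cannot in general be replaced by a larger one).
   Context: Let $\mathbb{D}=\{z\in\mathbb{C}:|z|<1\}$ and let $\mathcal{A}$ be the family of functions $f$ analytic in $\mathbb{D}$ with $f(0)=0$, $f'(0)=1$. The class $\mathcal{U}$ consists of all $f\in\mathcal{A}$ such that $\left|\left[\frac{z}{f(z)}\right]^2 f'(z)-1\right|<1$ for all $z\in\mathbb{D}$. *)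

(* Defs.v *)
From HB Require Import structures.
From mathcomp Require Import all_boot all_order all_algebra.
From mathcomp Require Import all_classical all_reals all_analysis.
From mathcomp Require Import complex.
Import Order.TTheory GRing.Theory Num.Theory.
Import numFieldNormedType.Exports.
Local Open Scope ring_scope.

Set Implicit Arguments.
Unset Strict Implicit.
Unset Printing Implicit Defensive.

Definition cderivable (R : realType) (f : R[i] -> R[i]) (z : R[i]) : Prop :=
  derivable (f : (R[i])^o -> (R[i])^o) (z : (R[i])^o) 1.

Definition cderiv (R : realType) (f : R[i] -> R[i]) (z : R[i]) : R[i] :=
  derive1 (f : (R[i])^o -> (R[i])^o) (z : (R[i])^o).

Definition analytic_in_disc (R : realType) (r : R[i]) (f : R[i] -> R[i]) : Prop :=
  forall z : R[i], `|z| < r -> cderivable f z.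

Definition classA (R : realType) (f : R[i] -> R[i]) : Prop :=
  [/\ analytic_in_disc 1 f, f 0 = 0 & cderiv f 0 = 1].

(* the class U.  The quantity z/f(z) is required to be defined (f(z) <> 0) for
   0 < |z| < 1; at z = 0 the expression [z/f(z)]^2 f'(z) - 1 takes its limiting
   value 0, so the inequality is only imposed for z <> 0. *)
Definition classU (R : realType) (f : R[i] -> R[i]) : Prop :=
  [/\ classA f,
      (forall z : R[i], `|z| < 1 -> z != 0 -> f z != 0) &
      (forall z : R[i], `|z| < 1 -> z != 0 ->
          `|(z / f z) ^+ 2 * cderiv f z - 1| < 1)].

Definition a2 (R : realType) (f : R[i] -> R[i]) : R[i] :=
  cderiv (cderiv f) 0 / 2.

(* g(z) = (z/f(z) - 1)/(-a_2), extended by its limiting value g(0) = 0 at z = 0 *)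
Definition gfun (R : realType) (f : R[i] -> R[i]) (z : R[i]) : R[i] :=
  if z == 0 then 0 else (z / f z - 1) / (- a2 f).

(* Main.v *)
Require Import Defs.
From HB Require Import structures.
From mathcomp Require Import all_boot all_order all_algebra.
From mathcomp Require Import all_classical all_reals all_analysis.
From mathcomp Require Import complex ring lra.
Import Order.TTheory GRing.Theory Num.Theory.
Import numFieldNormedType.Exports.
Import Normc.
Local Open Scope ring_scope.

Set Implicit Arguments.
Unset Strict Implicit.
Unset Printing Implicit Defensive.

(** For f in the class U write z / f(z) = 1 + z P(z).  Then
    (z / f(z))^2 f'(z) - 1 = - z^2 P'(z), so the maximum principle gives |P'| <= 1
    in the unit disc, P(0) = - a_2 and g(z) = z P(z) / P(0).  With W = P - P(0),
    |W(z)| <= |z|, parts (a) and (b) are direct estimates.  Part (c) amounts to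
    |a (z P' - W) - W^2| < |a + W|^2 with a = P(0); it follows from
    |z P' - W| <= 2 (|z| - |W|) for |z| < 1/2, which is obtained by integrating the
    Schwarz-Pick bound on P'' along a ray.  The bound |a_2| <= 2 keeps the disc
    |z| < |a_2| / 2 inside the unit disc.  The function z / (1 - z + z^2), for which
    g(z) = z - z^2, is extremal at z = 1/2.

    The needed complex analysis (existence of f'', removable singularities, maximum
    principle) is derived without integrals: line integrals are replaced by dyadic
    trapezoidal sums, for which Goursat's bisection argument works verbatim because
    they are exact on affine functions, and Cauchy's formula becomes a limit of
    finite sums. *)

(** * Complex derivatives in epsilon-delta form *)

Section Modulus.
Variable R : realType.
Local Notation C := (R[i]).
Implicit Types (z w : C) (x y : R).

(** Analyticity here is complex differentiability at each point, so even the second derivative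
    inside a_2 has to be earned from Cauchy's formula. The trapezoidal sums are never compared with
    an integral: contour sums of the same level n are compared with each other, and dividing by the
    sum of dz / z at that level replaces dividing by 2 i pi. The obstacle is (c). With r = |z|, the
    crude bounds |z P' - W| <= 2 r and |W| <= r would require 2 |a| r + r ^ 2 < (|a| - r) ^ 2, which
    holds only for r < |a| / 4. The two worst cases exclude each other: if |W| is close to |z|, then
    P' is nearly constant along the ray and z P' - W is small. A bound linear in |z| - |W| records
    this trade-off and recovers the full radius |a| / 2. *)

Lemma normc_ge0 z : 0 <= normc z.
Proof. by case: z => a b; rewrite sqrtr_ge0. Qed.

Lemma normC_normc z : `|z| = (normc z)%:C%C.
Proof. by []. Qed.

Lemma normc_eq0 z : (normc z == 0) = (z == 0).
Proof.
by apply/eqP/eqP => [/eq0_normc//|->]; exact: normc0.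
Qed.

Lemma normc_gt0 z : (0 < normc z) = (z != 0).
Proof. by rewrite lt0r normc_eq0 normc_ge0 andbT. Qed.

Lemma normc_real x : normc x%:C%C = `|x|.
Proof. by rewrite /= expr0n addr0 sqrtr_sqr. Qed.

Lemma normcB z w : normc (z - w) <= normc z + normc w.
Proof. by rewrite -(normcN w) le_normcD. Qed.

Lemma normc_sym z w : normc (z - w) = normc (w - z).
Proof. by rewrite -normcN opprB. Qed.

Lemma ler_distc z w : normc z - normc w <= normc (z - w).
Proof. by rewrite lerBlDr -{1}(subrK w z) le_normcD. Qed.

Lemma normc_dist z w : `|normc z - normc w| <= normc (z - w).
Proof.
have := ler_distc w z; have := ler_distc z w.
by rewrite (normc_sym w) ler_norml; lra.
Qed.

Lemma normcX z n : normc (z ^+ n) = normc z ^+ n.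
Proof.
by elim: n => [|n IH]; rewrite ?expr0 ?normc1 // !exprS normcM IH.
Qed.

Lemma normcD3 z1 z2 z3 : normc (z1 + z2 + z3) <= normc z1 + normc z2 + normc z3.
Proof. by apply: le_trans (le_normcD _ _) _; rewrite lerD2r le_normcD. Qed.

Lemma normc_conj z : normc z^*%C = normc z.
Proof. by case: z => a b /=; rewrite sqrrN. Qed.

Lemma normc_sqr z : normc z ^+ 2 = complex.Re z ^+ 2 + complex.Im z ^+ 2.
Proof. by case: z => a b /=; rewrite sqr_sqrtr // addr_ge0 ?sqr_ge0. Qed.

Lemma Re_le_normc z : complex.Re z <= normc z.
Proof.
apply: le_trans (ler_norm _) _.
rewrite -[X in X <= _]sqrtr_sqr; case: z => a b /=.
by rewrite ler_wsqrtr // lerDl sqr_ge0.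
Qed.

Lemma ReD z w : complex.Re (z + w) = complex.Re z + complex.Re w.
Proof. by case: z; case: w. Qed.
Lemma ReN z : complex.Re (- z) = - complex.Re z.
Proof. by case: z. Qed.
Lemma ReZ x z : complex.Re (x%:C%C * z) = x * complex.Re z.
Proof. by case: z => a b /=; rewrite mul0r subr0. Qed.

(** Turns a modulus into the real part of a rotated value, so that a bound on it can be obtained by
    differentiating a real function along a ray. *)
Lemma normc_phase z : exists e : C, normc e = 1 /\ e * z = (normc z)%:C%C.
Proof.
have [->|z0] := eqVneq z 0; first by exists 1; rewrite normc1 normc0 mulr0.
exists ((normc z)%:C%C / z); rewrite divfK // normcM normcV normc_real.
by rewrite ger0_norm ?normc_ge0 // divff // normc_eq0.
Qed.
End Modulus.

Section ComplexDerivative.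
Local Open Scope classical_set_scope.
Variable R : realType.
Local Notation C := (R[i]).
Implicit Types (f g : C -> C) (a b z l k : C) (e d : R).

Definition cdrv f a l := is_derive (a : C^o) (1 : C^o) (f : C^o -> C^o) (l : C^o).

Lemma cdrv_cvg f a l : cdrv f a l <->
  (fun h : C^o => h^-1 *: ((f : C^o -> C^o) (h *: (1 : C^o) + a) - f a))
    @ (0 : C^o)^' --> (l : C^o).
Proof.
split=> [[df <-]|fl]; first exact: df.
by split; [exact: cvgP fl|exact: cvg_lim fl].
Qed.

(** Multiplying out by |z - a| makes z = a harmless, and [e], [d] are real numbers whereas the balls
    of [C] have radii in [C]. *)
Lemma cdrvP f a l : cdrv f a l <->
  forall e, 0 < e -> exists d, 0 < d /\ forall z, normc (z - a) < d ->
    normc (f z - f a - l * (z - a)) <= e * normc (z - a).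
Proof.
rewrite cdrv_cvg; split=> [/cvgrPdist_le fl e e0|fl].
  have /fl : 0 < e%:C%C :> C by rewrite ltcR.
  rewrite /dnbhs near_withinE => /nbhs_ballP[d /= d0 dP].
  (* A positive element of [C] is real, hence equal to its real part. *)
  have d1E : d = (complex.Re d)%:C%C by rewrite RRe_real // gtr0_real.
  exists (complex.Re d); split; first by rewrite d1E ltcR in d0.
  move=> z zd; have [->|za] := eqVneq z a.
    by rewrite !subrr mulr0 subrr normc0 mulr0.
  have za0 : z - a != 0 by rewrite subr_eq0.
  have := dP (z - a); rewrite -ball_normE /= sub0r normrN d1E ltcR => /(_ zd za0).
  rewrite /GRing.scale /= mulr1 subrK normC_normc lecR => h.
  rewrite -normcN -ler_pdivrMr ?normc_gt0 // -normcV -normcM.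
  suff -> : - (f z - f a - l * (z - a)) / (z - a) = l - (z - a)^-1 * (f z - f a) by [].
  by field.
apply/cvgrPdist_le => e e0.
have eE : e = (complex.Re e)%:C%C by rewrite RRe_real // gtr0_real.
have e10 : 0 < complex.Re e by rewrite eE ltcR in e0.
have [d [d0 dP]] := fl _ e10.
rewrite /dnbhs near_withinE; apply/nbhs_ballP; exists d%:C%C; first by rewrite /= ltcR.
move=> h; rewrite -ball_normE /= sub0r normrN normC_normc ltcR => hd h0.
rewrite normC_normc eE lecR.
have := dP (h + a); rewrite addrK => /(_ hd).
rewrite -ler_pdivrMr ?normc_gt0 // -normcV -normcM -normcN.
suff -> : - ((f (h + a) - f a - l * h) / h) = l - h^-1 *: (f (h *: 1 + a) - f a) by [].
by rewrite /GRing.scale /= mulr1; field.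
Qed.

Lemma cderiv_cdrv f a l : cdrv f a l -> cderiv f a = l.
Proof. by move=> [_ dl]; rewrite /cderiv derive1E. Qed.

Lemma cderivableP f a : cderivable f a <-> exists l, cdrv f a l.
Proof.
split=> [df|[l []//]].
by exists (cderiv f a); apply: DeriveDef; [exact: df|rewrite /cderiv derive1E].
Qed.

Lemma cdrv_unique f a l k : cdrv f a l -> cdrv f a k -> l = k.
Proof. by move=> /cderiv_cdrv <- /cderiv_cdrv. Qed.

Lemma cdrv_cst k a : cdrv (fun=> k) a 0.
Proof. exact: is_derive_cst. Qed.

Lemma cdrv_id a : cdrv id a 1.
Proof. exact: is_derive_id. Qed.

Lemma cdrv_eq f a l k : cdrv f a l -> l = k -> cdrv f a k.
Proof. by move=> ? <-. Qed.

Lemma cdrvD f g a l k : cdrv f a l -> cdrv g a k ->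
  cdrv (fun z => f z + g z) a (l + k).
Proof. by move=> fl gk; exact: (is_deriveD fl gk). Qed.

Lemma cdrvN f a l : cdrv f a l -> cdrv (fun z => - f z) a (- l).
Proof. by move=> fl; exact: (is_deriveN fl). Qed.

Lemma cdrvB f g a l k : cdrv f a l -> cdrv g a k ->
  cdrv (fun z => f z - g z) a (l - k).
Proof. by move=> fl gk; apply: cdrvD => //; exact: cdrvN. Qed.

Lemma cdrvM f g a l k : cdrv f a l -> cdrv g a k ->
  cdrv (fun z => f z * g z) a (f a * k + g a * l).
Proof.
by move=> fl gk; exact: (@is_deriveM _ C^o (f : C^o -> C^o) g a 1 l k fl gk).
Qed.

Lemma cdrvX f n a l : cdrv f a l ->
  cdrv (fun z => f z ^+ n) a (n%:R * f a ^+ n.-1 * l).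
Proof.
move=> fl; have := @is_deriveX _ C^o (f : C^o -> C^o) n a 1 l fl.
by rewrite exprfctE.
Qed.

Lemma cdrvV f a l : cdrv f a l -> f a != 0 ->
  cdrv (fun z => (f z)^-1) a (- l / f a ^+ 2).
Proof.
move=> [df dl] fa0; split; first exact: derivableV.
by rewrite deriveV // dl /GRing.scale /= mulNr mulrC -mulNr.
Qed.

Lemma cdrv_near f g a l d : 0 < d ->
  (forall z, normc (z - a) < d -> f z = g z) -> cdrv f a l -> cdrv g a l.
Proof.
move=> d0 fg /cdrvP fl; apply/cdrvP => e /fl[d' [d'0 d'P]].
exists (Num.min d d'); split; first by rewrite lt_min d0.
move=> z; rewrite lt_min => /andP[zd zd'].
rewrite -(fg z) // -(fg a) ?subrr ?normc0 //; exact: d'P.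
Qed.

Lemma cdrv_continuous f a l : cdrv f a l ->
  forall e, 0 < e -> exists d, 0 < d /\ forall z, normc (z - a) < d ->
    normc (f z - f a) <= e.
Proof.
move=> /cdrvP/(_ 1 ltr01)[d [d0 dP]] e e0.
have L0 : 0 < 1 + normc l by rewrite ltr_pwDl ?ltr01 ?normc_ge0.
exists (Num.min d (e / (1 + normc l))); split; first by rewrite lt_min d0 divr_gt0.
move=> z; rewrite lt_min => /andP[/dP zd].
rewrite ltr_pdivlMr // mulrC => /ltW; apply: le_trans.
rewrite mulrDl -normcM -[f z - f a](subrK (l * (z - a))).
by apply: le_trans (le_normcD _ _) _; rewrite lerD2r.
Qed.

Lemma cdrv_shift f a c l : cdrv f (c + a) l -> cdrv (fun z => f (c + z)) a l.
Proof.
move=> /cdrvP fl; apply/cdrvP => e /fl[d [d0 dP]]; exists d; split => // z zd.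
have := dP (c + z); rewrite (_ : c + z - (c + a) = z - a); last by ring.
exact.
Qed.
End ComplexDerivative.

(** * Goursat's theorem for trapezoidal sums *)

Section Trapezoid.
Variable R : realType.
Local Notation C := (R[i]).
Implicit Types (q : C -> C) (p : R -> C) (x l : R) (n : nat).

(* Trapezoidal sum for the integral of q(z) dz along p restricted to
   [x, x + l], with 2 ^ n equal steps. *)
Fixpoint trap q p n x l : C :=
  if n is m.+1 then trap q p m x (l / 2) + trap q p m (x + l / 2) (l / 2)
  else (q (p x) + q (p (x + l))) / 2 * (p (x + l) - p x).

Lemma halfK x l : x + l / 2 + l / 2 = x + l.
Proof. lra. Qed.

Lemma eq_trap q q' p p' n x l : 0 <= l ->
  (forall y, x <= y <= x + l -> p y = p' y /\ q (p y) = q' (p' y)) ->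
  trap q p n x l = trap q' p' n x l.
Proof.
elim: n x l => [|n IH] x l l0 E /=.
  have [|-> ->] := E x; first by rewrite lexx lerDl.
  by have [|-> ->] := E (x + l); first by rewrite lexx lerDl l0.
by congr (_ + _); apply: IH => [|y ?]; try (apply: E); lra.
Qed.

Lemma trapD q q' p n x l :
  trap (fun z => q z + q' z) p n x l = trap q p n x l + trap q' p n x l.
Proof.
elim: n x l => [|n IH] x l /=; last by rewrite !IH addrACA.
by rewrite -mulrDl -mulrDl addrACA.
Qed.

Lemma trapZ k q p n x l :
  trap (fun z => k * q z) p n x l = k * trap q p n x l.
Proof.
elim: n x l => [|n IH] x l /=; last by rewrite !IH mulrDr.
by rewrite -mulrDr !mulrA.
Qed.

Lemma trapB q q' p n x l :
  trap (fun z => q z - q' z) p n x l = trap q p n x l - trap q' p n x l.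
Proof.
rewrite -[- trap q' _ _ _ _]mulN1r -trapZ -trapD.
by congr trap; apply/funext => z; rewrite mulN1r.
Qed.

(** The right-hand side is the increment of the primitive a z ^ 2 / 2 + b z, so the sum telescopes
    and does not depend on the level. *)
Lemma trap_affine a b p n x l :
  trap (fun z => a * z + b) p n x l =
  (a * (p (x + l) + p x) / 2 + b) * (p (x + l) - p x).
Proof.
elim: n x l => [|n IH] x l /=; first by field.
by rewrite !IH halfK; field.
Qed.

(** The usual estimate by maximum times length: K * l bounds the length of the path, uniformly in
    the level n. *)
Lemma trap_bound q p n x l (M K : R) : 0 <= l -> 0 <= M ->
  (forall y, x <= y <= x + l -> normc (q (p y)) <= M) ->
  (forall y y', x <= y <= x + l -> x <= y' <= x + l ->
     normc (p y - p y') <= K * `|y - y'|) ->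
  normc (trap q p n x l) <= M * K * l.
Proof.
move=> l0 M0; elim: n x l l0 => [|n IH] x l l0 qM pK /=.
  rewrite normcM -mulrA ler_pM ?normc_ge0 //.
    rewrite normcM normcV.
    have -> : normc (2 : C) = 2.
      by rewrite -[2]/(2%:R) -(rmorph_nat (real_complex R)) normc_real ger0_norm.
    rewrite ler_pdivrMr //; apply: le_trans (le_normcD _ _) _.
    by rewrite mulr_natr mulr2n lerD ?qM //; lra.
  by have := pK (x + l) x; rewrite [x + l - x]addrC addKr ger0_norm //; apply; lra.
apply: le_trans (le_normcD _ _) _.
have -> : M * K * l = M * K * (l / 2) + M * K * (l / 2) by lra.
apply: lerD; apply: IH => [|y ?|y y' ? ?]; try (by lra); try (apply: qM); try (apply: pK); lra.
Qed.
End Trapezoid.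

Section Intervals.
Variable R : realType.
Implicit Types x y s t h : R.

Lemma itv_dist x s t h : x <= s <= x + h -> x <= t <= x + h -> `|s - t| <= h.
Proof. by move=> sP tP; rewrite ler_norml; lra. Qed.

Lemma itv_sub x h s : 0 <= x -> x + h <= 1 -> x <= s <= x + h -> 0 <= s <= 1.
Proof. lra. Qed.

Lemma itv_half x y h : 0 <= h -> y = x \/ y = x + h / 2 ->
  x <= y /\ y + h / 2 <= x + h.
Proof. by move=> h0 [->|->]; split; lra. Qed.
End Intervals.

(** * Bisection of a parameter square *)

Section Goursat.
Variable R : realType.
Local Notation C := (R[i]).
Implicit Types (q : C -> C) (g : R -> R -> C) (s t h e : R).

(** Sum around the image under [g] of the square of side h with lower corner (s, t), traversed
    counterclockwise in the parameters. *)
Definition bd q g n s t h : C :=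
  trap q (g ^~ t) n s h + trap q (g (s + h)) n t h
  - trap q (g ^~ (t + h)) n s h - trap q (g s) n t h.

(** The inner edges cancel: raising the level by one is exactly a subdivision into quarters, without
    error term. *)
Lemma bdS q g n s t h : bd q g n.+1 s t h =
  bd q g n s t (h / 2) + bd q g n (s + h / 2) t (h / 2) +
  bd q g n s (t + h / 2) (h / 2) + bd q g n (s + h / 2) (t + h / 2) (h / 2).
Proof. by rewrite /bd /= !halfK; ring. Qed.

Lemma bdB q q' g n s t h :
  bd (fun z => q z - q' z) g n s t h = bd q g n s t h - bd q' g n s t h.
Proof. by rewrite /bd !trapB; ring. Qed.

Lemma bd_affine a b g n s t h : bd (fun z => a * z + b) g n s t h = 0.
Proof. by rewrite /bd !trap_affine; field. Qed.

Lemma nested_limit (x h : nat -> R) : (forall k, 0 <= h k) ->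
  (forall k, x k <= x k.+1) -> (forall k, x k.+1 + h k.+1 <= x k + h k) ->
  exists y, forall k, x k <= y <= x k + h k.
Proof.
move=> h0 xle xhge.
have xmono m k : (m <= k)%N -> x m <= x k.
  by move=> /subnK <-; elim: (k - m)%N => // j IH; rewrite addSn (le_trans IH).
have xhmono m k : (m <= k)%N -> x k + h k <= x m + h m.
  by move=> /subnK <-; elim: (k - m)%N => // j IH; rewrite addSn (le_trans (xhge _)).
have xh j k : x j <= x k + h k.
  apply: le_trans (xhmono k (maxn j k) (leq_maxr _ _)).
  by apply: le_trans (xmono _ _ (leq_maxl j k)) _; rewrite lerDl.
exists (sup (range x)) => k; apply/andP; split.
  apply: ub_le_sup; last by exists k.
  by exists (x 0%N + h 0%N) => _ [j _ <-].
by apply: ge_sup; [exists (x 0%N); exists 0%N|move=> _ [j _ <-]].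
Qed.

(** The negation of being eventually below e. Each bisection uses up one level, so the defect must
    occur at arbitrarily high levels. *)
Definition bad q g e s t h :=
  forall N, exists2 n, (N <= n)%N & e <= normc (bd q g n s t h).

Lemma bad_split q g e s t h : bad q g e s t h ->
  exists s' t', [/\ s' = s \/ s' = s + h / 2, t' = t \/ t' = t + h / 2 &
    bad q g (e / 4) s' t' (h / 2)].
Proof.
move=> B; apply: contrapT => nB.
have good s' t' : s' = s \/ s' = s + h / 2 -> t' = t \/ t' = t + h / 2 ->
    exists N, forall n, (N <= n)%N -> normc (bd q g n s' t' (h / 2)) < e / 4.
  move=> s'E t'E; apply: contrapT => nG; apply: nB; exists s', t'; split => //.
  move=> N; apply: contrapT => nN; apply: nG; exists N => n Nn.
  by rewrite ltNge; apply/negP => ?; apply: nN; exists n.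
have [N1 P1] := good s t (or_introl erefl) (or_introl erefl).
have [N2 P2] := good (s + h / 2) t (or_intror erefl) (or_introl erefl).
have [N3 P3] := good s (t + h / 2) (or_introl erefl) (or_intror erefl).
have [N4 P4] := good (s + h / 2) (t + h / 2) (or_intror erefl) (or_intror erefl).
(* The successor provides the level that [bdS] consumes. *)
have [[//|n]] := B (maxn (maxn N1 N2) (maxn N3 N4)).+1.
rewrite ltnS !geq_max => /andP[/andP[/P1 b1 /P2 b2] /andP[/P3 b3 /P4 b4]].
rewrite leNgt => /negP; apply; rewrite bdS.
apply: le_lt_trans (le_normcD _ _) _.
apply: le_lt_trans (lerD (normcD3 _ _ _) (lexx _)) _.
lra.
Qed.

(** If the sums stay above e, bisection gives nested squares of side h = 2 ^- k whose sums reach e h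
    ^ 2. At their common point [q] is affine up to an error e' times the distance, which bounds the
    same sums by a smaller multiple of h ^ 2. *)
Lemma goursat q g (K : R) : 0 <= K ->
  (forall s t, 0 <= s <= 1 -> 0 <= t <= 1 -> exists l, cdrv q (g s t) l) ->
  (forall s t s' t', 0 <= s <= 1 -> 0 <= t <= 1 -> 0 <= s' <= 1 -> 0 <= t' <= 1 ->
     normc (g s t - g s' t') <= K * (`|s - s'| + `|t - t'|)) ->
  forall e, 0 < e ->
    exists N, forall n, (N <= n)%N -> normc (bd q g n 0 0 1) < e.
Proof.
move=> K0 qd gK e e0; apply: contrapT => nG.
have B0 : bad q g e 0 0 1.
  move=> N; apply: contrapT => nN; apply: nG; exists N => n Nn.
  by rewrite ltNge; apply/negP => ?; apply: nN; exists n.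
(* The badness premise sits under the existential, so the statement holds for every square and
   [choice] returns a total function; its value off the bad squares is arbitrary. *)
have step (x : R * R * nat) : exists y : R * R,
    bad q g (e / 4 ^+ x.2) x.1.1 x.1.2 (2 ^- x.2) ->
    [/\ y.1 = x.1.1 \/ y.1 = x.1.1 + 2 ^- x.2 / 2,
        y.2 = x.1.2 \/ y.2 = x.1.2 + 2 ^- x.2 / 2 &
        bad q g (e / 4 ^+ x.2.+1) y.1 y.2 (2 ^- x.2.+1)].
  have [B|nB] := pselect (bad q g (e / 4 ^+ x.2) x.1.1 x.1.2 (2 ^- x.2)).
    have [s' [t' [Es Et B']]] := bad_split B; exists (s', t') => _; split => //.
    by rewrite !exprSr !invfM mulrA.
  by exists x.1.
have [f fP] := choice step.
pose c := fix c k : R * R := if k is j.+1 then f (c j, j) else (0, 0).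
have cB k : bad q g (e / 4 ^+ k) (c k).1 (c k).2 (2 ^- k).
  elim: k => [|k IH]; first by rewrite !expr0 divr1 invr1.
  by have [] := fP (c k, k) IH.
have h0 k : 0 < (2 : R) ^- k by rewrite invr_gt0 exprn_gt0.
have hS k : (2 : R) ^- k.+1 = 2 ^- k / 2 by rewrite exprSr invfM.
have cP k : [/\ (c k).1 <= (c k.+1).1, (c k.+1).1 + 2 ^- k.+1 <= (c k).1 + 2 ^- k,
    (c k).2 <= (c k.+1).2 & (c k.+1).2 + 2 ^- k.+1 <= (c k).2 + 2 ^- k].
  have [/= /(itv_half (ltW (h0 k)))[? ?] /(itv_half (ltW (h0 k)))[? ?] _] := fP (c k, k) (cB k).
  by rewrite hS.
have [s sP] : exists s, forall k, (c k).1 <= s <= (c k).1 + 2 ^- k.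
  by apply: nested_limit => k; [exact: ltW|case: (cP k)..].
have [t tP] : exists t, forall k, (c k).2 <= t <= (c k).2 + 2 ^- k.
  by apply: nested_limit => k; [exact: ltW|case: (cP k)..].
have c01 k : [/\ 0 <= (c k).1, (c k).1 + 2 ^- k <= 1, 0 <= (c k).2 & (c k).2 + 2 ^- k <= 1].
  elim: k => [|k [a1 a2 a3 a4]] /=; first by rewrite expr0 invr1; split; lra.
  have [b1 b2 b3 b4] := cP k.
  by split; [exact: le_trans b1|exact: le_trans a2|exact: le_trans b3|exact: le_trans a4].
have s01 : 0 <= s <= 1 by have [? ? _ _] := c01 0%N; exact: itv_sub (sP 0%N).
have t01 : 0 <= t <= 1 by have [_ _ ? ?] := c01 0%N; exact: itv_sub (tP 0%N).
have [l /cdrvP ql] := qd s t s01 t01.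
have K1 : 0 < K ^+ 2 + 1 by rewrite ltr_wpDl ?sqr_ge0.
(* Each of the four edges contributes at most e' * 2 K h * K h, in total 8 e' K ^ 2 h ^ 2; the added
   1 makes the comparison with e h ^ 2 strict, also for K = 0. *)
have e'0 : 0 < e / (8 * (K ^+ 2 + 1)) by rewrite divr_gt0 // mulr_gt0.
have [d [d0 dP]] := ql _ e'0; set e' := e / _ in e'0 dP.
pose k := Num.bound (2 * K / d).
have kP : 2 * K * 2 ^- k < d.
  rewrite ltr_pdivrMr ?exprn_gt0 // [d * _]mulrC -ltr_pdivrMr //.
  exact: upper_nthrootP.
have [n _] := cB k 0%N.
have [a1 a2 a3 a4] := c01 k; have := sP k; have := tP k; have := h0 k.
set h := 2 ^- k in kP a2 a4 *; set x := (c k).1 in a1 a2 *.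
set y := (c k).2 in a3 a4 * => h_gt0 yP xP.
(* Subtracting the affine approximation of [q] at [g s t] leaves the boundary sum unchanged. *)
have -> : bd q g n x y h = bd (fun z => q z - (l * z + (q (g s t) - l * g s t))) g n x y h.
  by rewrite bdB bd_affine subr0.
have near s' t' : x <= s' <= x + h -> y <= t' <= y + h ->
    normc (g s' t' - g s t) <= K * (h + h).
  move=> s'P t'P; have s'1 := itv_sub a1 a2 s'P; have t'1 := itv_sub a3 a4 t'P.
  apply: le_trans (gK _ _ _ _ s'1 t'1 s01 t01) _.
  by rewrite ler_wpM2l //; apply: lerD; [exact: itv_dist xP|exact: itv_dist yP].
have qe s' t' : x <= s' <= x + h -> y <= t' <= y + h ->
    normc (q (g s' t') - (l * g s' t' + (q (g s t) - l * g s t))) <= e' * (K * (h + h)).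
  move=> s'P t'P; have nst := near _ _ s'P t'P.
  rewrite (_ : _ - _ = q (g s' t') - q (g s t) - l * (g s' t' - g s t)); last by ring.
  apply: le_trans (dP _ _) _; last by rewrite ler_wpM2l // ltW.
  by apply: le_lt_trans nst _; rewrite -mulr2n -mulr_natl mulrCA mulrA.
have M0 : 0 <= e' * (K * (h + h)).
  by have h_ge0 := ltW h_gt0; apply: mulr_ge0; [exact: ltW|apply: mulr_ge0 => //; exact: addr_ge0].
set q' := (fun z => _).
have endl v : v <= v <= v + h by rewrite lexx lerDl ltW.
have endr v : v <= v + h <= v + h by rewrite lexx lerDl ltW.
have x01 v := @itv_sub _ x h v a1 a2; have y01 v := @itv_sub _ y h v a3 a4.
have x0 := x01 _ (endl x); have xh0 := x01 _ (endr x).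
have y0 := y01 _ (endl y); have yh0 := y01 _ (endr y).
have lb (p : R -> C) u : (forall v, u <= v <= u + h -> normc (q' (p v)) <= e' * (K * (h + h))) ->
    (forall v v', u <= v <= u + h -> u <= v' <= u + h ->
       normc (p v - p v') <= K * `|v - v'|) ->
    normc (trap q' p n u h) <= e' * (K * (h + h)) * K * h.
  by apply: trap_bound => //; exact: ltW.
have b1 : normc (trap q' (g ^~ y) n x h) <= e' * (K * (h + h)) * K * h.
  apply: lb => [v vP|v v' vP v'P]; first by apply: qe.
  by have := gK _ _ _ _ (x01 _ vP) y0 (x01 _ v'P) y0; rewrite subrr normr0 addr0.
have b2 : normc (trap q' (g (x + h)) n y h) <= e' * (K * (h + h)) * K * h.
  apply: lb => [v vP|v v' vP v'P]; first by apply: qe.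
  by have := gK _ _ _ _ xh0 (y01 _ vP) xh0 (y01 _ v'P); rewrite subrr normr0 add0r.
have b3 : normc (trap q' (g ^~ (y + h)) n x h) <= e' * (K * (h + h)) * K * h.
  apply: lb => [v vP|v v' vP v'P]; first by apply: qe.
  by have := gK _ _ _ _ (x01 _ vP) yh0 (x01 _ v'P) yh0; rewrite subrr normr0 addr0.
have b4 : normc (trap q' (g x) n y h) <= e' * (K * (h + h)) * K * h.
  apply: lb => [v vP|v v' vP v'P]; first by apply: qe.
  by have := gK _ _ _ _ x0 (y01 _ vP) x0 (y01 _ v'P); rewrite subrr normr0 add0r.
rewrite leNgt => /negP; apply; rewrite /bd.
apply: le_lt_trans (normcB _ _) _.
apply: le_lt_trans (lerD (normcB _ _) (lexx _)) _.
apply: le_lt_trans (lerD (lerD (le_normcD _ _) (lexx _)) (lexx _)) _.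
apply: (@le_lt_trans _ _ (8 * e' * K ^+ 2 * h ^+ 2)).
  move: b1 b2 b3 b4; rewrite (_ : _ * K * h = 2 * e' * K ^+ 2 * h ^+ 2); last by ring.
  lra.
have -> : e / 4 ^+ k = e * h ^+ 2.
  by rewrite /h exprVn -exprM mulnC exprM (_ : 2 ^+ 2 = 4 :> R) //; ring.
rewrite ltr_pM2r ?exprn_gt0 // /e' invfM.
rewrite (_ : _ * _ * _ = e * (K ^+ 2 / (K ^+ 2 + 1))); last by field; rewrite gt_eqF.
by rewrite gtr_pMr // ltr_pdivrMr // mul1r ltrDl.
Qed.
End Goursat.

(** * Cauchy's formula *)

Section Circle.
Variable R : realType.
Local Notation C := (R[i]).
Implicit Types (f : C -> C) (a z : C) (r s t x l : R) (n : nat).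

Lemma lipschitz_MVT (phi dphi : R -> R) : (forall x, is_derive x 1 phi (dphi x)) ->
  (forall x, `|dphi x| <= 1) -> forall x y, `|phi x - phi y| <= `|x - y|.
Proof.
move=> dP d1 x y; wlog yx : x y / y <= x.
  move=> H; have [yx|xy] := leP y x; first exact: H.
  by rewrite distrC [leRHS]distrC; apply: H; exact: ltW.
have [|c _ ->] := @MVT_segment _ phi dphi y x yx (fun c _ => dP c).
  apply: continuous_subspaceT => z; apply: differentiable_continuous.
  by apply/derivable1_diffP; have [] := dP z.
by rewrite normrM ler_piMl.
Qed.

Definition circle t : C := (cos (2 * pi * t) +i* sin (2 * pi * t))%C.

Lemma normc_circle t : normc (circle t) = 1.
Proof. by rewrite /= cos2Dsin2 sqrtr1. Qed.

Lemma circleD s t : circle (s + t) = circle s * circle t.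
Proof.
rewrite /circle mulrDr cosD sinD; simpc; congr (_ +i* _)%C.
by rewrite addrC mulrC [X in _ + X]mulrC.
Qed.

Lemma circle_neq0 t : circle t != 0.
Proof. by rewrite -normc_gt0 normc_circle. Qed.

Lemma circle0 : circle 0 = 1.
Proof. by rewrite /circle mulr0 cos0 sin0. Qed.

Lemma circle1 : circle 1 = 1.
Proof. by rewrite /circle mulr1 mulr_natl cos2pi sin2pi. Qed.

(** Both coordinates are 2 pi-Lipschitz; bounding sqrt 2 by 2 gives 4 pi in place of the sharp 2 pi,
    and only finiteness of the constant matters later. *)
Lemma circle_lipschitz s t : normc (circle s - circle t) <= 4 * pi * `|s - t|.
Proof.
have cosL : `|cos (2 * pi * s) - cos (2 * pi * t)| <= `|2 * pi * s - 2 * pi * t| :> R.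
  apply: (lipschitz_MVT (dphi := fun x => - sin x)) => x.
  by rewrite normrN sin_max.
have sinL : `|sin (2 * pi * s) - sin (2 * pi * t)| <= `|2 * pi * s - 2 * pi * t| :> R.
  by apply: (lipschitz_MVT (dphi := cos)) => x; exact: cos_max.
have E : `|2 * pi * s - 2 * pi * t| = 2 * pi * `|s - t| :> R.
  by rewrite -mulrBr normrM ger0_norm // mulr_ge0 ?pi_ge0.
rewrite E in cosL sinL; have L0 : 0 <= 2 * pi * `|s - t| by rewrite -E.
apply: (@le_trans _ _ (2 * (2 * pi * `|s - t|))); last by rewrite !mulrA -natrM.
suff : normc (circle s - circle t) ^+ 2 <= (2 * (2 * pi * `|s - t|)) ^+ 2.
  by rewrite ler_pXn2r // nnegrE ?normc_ge0 // mulr_ge0.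
rewrite normc_sqr /=.
move: cosL sinL L0; set A := cos _ - cos _; set B := sin _ - sin _; set M := 2 * pi * `|_| => *.
have A2 : A ^+ 2 <= M ^+ 2 by rewrite -[A ^+ 2]real_normK ?num_real // ler_pXn2r.
have B2 : B ^+ 2 <= M ^+ 2 by rewrite -[B ^+ 2]real_normK ?num_real // ler_pXn2r.
by rewrite exprMn; move: A2 B2 (sqr_ge0 M); set N := M ^+ 2; lra.
Qed.

(** The trapezoidal sum of dz / z around the unit circle with 2 ^ n steps is i times this number,
    which plays the role of 2 pi. *)
Definition kappa n : R := 2 ^+ n * sin (2 * pi / 2 ^+ n).

Lemma kappaS n : kappa n.+1 = 2 * (2 ^+ n * sin (2 * pi / 2 ^+ n / 2)).
Proof.
by rewrite /kappa exprS -mulrA; congr (_ * (_ * sin _)); rewrite invfM mulrA mulrAC.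
Qed.

(** The double angle formula makes [kappa] nondecreasing from [kappa 2 = 4] on. Levels 0 and 1 are
    degenerate, with [kappa] equal to 0. *)
Lemma kappa_ge4 n : (2 <= n)%N -> 4 <= kappa n.
Proof.
elim: n => // n IH; rewrite leq_eqVlt => /orP[/eqP[<-]|n2].
  rewrite kappaS expr1 (_ : 2 * pi / 2 / 2 = pi / 2); last by field.
  by rewrite sin_pihalf; lra.
apply: le_trans (IH n2) _; rewrite kappaS /kappa.
set x := 2 * pi / 2 ^+ n / 2.
have -> : 2 * pi / 2 ^+ n = x *+ 2 by rewrite /x; lra.
have -> : sin (x *+ 2) = 2 * (cos x * sin x) by rewrite sin_mulr2n mulr_natl.
rewrite mulrCA !ler_pM2l ?exprn_gt0 //.
rewrite ler_piMl ?cos_le1 //.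
apply: sin_ge0_pi; have p0 := pi_ge0 R; apply/andP; split.
  by rewrite /x !divr_ge0 ?mulr_ge0 ?exprn_ge0.
rewrite /x mulrAC [2 * pi]mulrC mulfK //.
by rewrite ler_pdivrMr ?exprn_gt0 // ler_peMr // exprn_ege1 // ler1n.
Qed.

(** A single step from circle x to circle (x + l) contributes (w - 1 / w) / 2 with w = circle l,
    that is i sin (2 pi l), whatever x is. Hence the sum is known exactly at every level. *)
Lemma trap_circle_inv a r n x l : 0 < r ->
  trap (fun z => (z - a)^-1) (fun t => a + r%:C%C * circle t) n x l =
  'i%C * (2 ^+ n * sin (2 * pi * l / 2 ^+ n))%:C%C.
Proof.
move=> r0; elim: n x l => [|n IH] x l /=.
  have r0' : r%:C%C != 0 :> C by rewrite fmorph_eq0 gt_eqF.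
  have cx := circle_neq0 x; have cl := circle_neq0 l.
  rewrite circleD expr0 mul1r divr1 ![a + _]addrC !addrK.
  have -> : 'i%C * (sin (2 * pi * l))%:C%C = (circle l - (circle l)^-1) / 2 :> C.
    rewrite (_ : (circle l)^-1 = (circle l)^*%C); last first.
      by rewrite invc_norm normC_normc normc_circle expr1n invr1 mul1r.
    by rewrite subcJ -[sin _]/(complex.Im (circle l)); set S := _%:C%C; set I := 'i%C; field.
  by field; apply/and3P; split; [exact: cl|exact: cx|exact: r0'].
rewrite !IH -mulrDr -rmorphD /=; congr ('i%C * _%:C%C).
have -> : 2 * pi * l / 2 ^+ n.+1 = 2 * pi * (l / 2) / 2 ^+ n by rewrite exprS invfM; ring.
by rewrite exprS; ring.
Qed.
End Circle.

(** * Cauchy's formula by deforming a circle onto a small circle about the pole *)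

Section CauchyFormula.
Variable R : realType.
Local Notation C := (R[i]).
Implicit Types (f q : C -> C) (a z l : C) (r s t d e rho : R) (n : nat).

Definition cdrv_on f r := forall z, normc z <= r -> exists l, cdrv f z l.

Definition rcircle r t : C := r%:C%C * circle t.

Lemma normc_rcircle r t : 0 <= r -> normc (rcircle r t) = r.
Proof. by move=> r0; rewrite normcM normc_circle normc_real mulr1 ger0_norm. Qed.

Lemma normc_cvx (s : R) z1 z2 x1 x2 : 0 <= s <= 1 -> normc z1 <= x1 -> normc z2 <= x2 ->
  normc ((1 - s)%:C%C * z1 + s%:C%C * z2) <= (1 - s) * x1 + s * x2.
Proof.
move=> /andP[s0 s1] zx1 zx2; have s1' : 0 <= 1 - s by rewrite subr_ge0.
apply: le_trans (le_normcD _ _) _; rewrite !normcM !normc_real !ger0_norm //.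
by rewrite lerD // ler_wpM2l.
Qed.

Definition circle_homotopy a r rho s t : C :=
  (1 - s)%:C%C * rcircle r t + s%:C%C * (a + rcircle rho t).

Section Homotopy.
Variables (a : C) (r rho : R).
Hypotheses (rho0 : 0 < rho) (arho : normc a + rho <= r).
Let r0 : 0 <= r.
Proof. by apply: le_trans arho; rewrite addr_ge0 ?normc_ge0 // ltW. Qed.

Lemma circle_homotopy_le s t : 0 <= s <= 1 ->
  normc (circle_homotopy a r rho s t) <= r.
Proof.
move=> s01; apply: le_trans (normc_cvx s01 (x1 := r) (x2 := r) _ _) _.
- by rewrite normc_rcircle.
- by apply: le_trans (le_normcD _ _) _; rewrite normc_rcircle // ltW.
- by rewrite -mulrDl subrK mul1r.
Qed.

(** The deformation stays away from the pole: its distance to a is at least (1 - s) (r - |a|) + s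
    rho, and r - |a| >= rho. *)
Lemma circle_homotopy_ge s t : 0 <= s <= 1 ->
  rho <= normc (circle_homotopy a r rho s t - a).
Proof.
move=> s01; have /andP[s0 s1] := s01; have s1' : 0 <= 1 - s by rewrite subr_ge0.
rewrite (_ : _ - a = ((1 - s) * r + s * rho)%:C%C * circle t - (1 - s)%:C%C * a); last first.
  by rewrite /circle_homotopy /rcircle !rmorphD !rmorphM rmorphN rmorph1; ring.
apply: le_trans (ler_distc _ _).
rewrite !normcM normc_circle !normc_real mulr1 [`|1 - s|]ger0_norm // ger0_norm; last first.
  by rewrite addr_ge0 ?mulr_ge0 // ltW.
rewrite addrAC -mulrBr.
have : (1 - s) * rho <= (1 - s) * (r - normc a) by rewrite ler_wpM2l // lerBrDl.
lra.
Qed.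

Lemma circle_homotopy_lipschitz s t s' t' : 0 <= s <= 1 ->
  normc (circle_homotopy a r rho s t - circle_homotopy a r rho s' t') <=
    (4 * pi * r + 2 * r) * (`|s - s'| + `|t - t'|).
Proof.
move=> s01; have /andP[s0 s1] := s01; have s1' : 0 <= 1 - s by rewrite subr_ge0.
have rho_r : rho <= r by apply: le_trans arho; rewrite lerDr normc_ge0.
have ar : normc a <= r by apply: le_trans arho; rewrite lerDl ltW.
rewrite (_ : _ - _ = ((1 - s) * r + s * rho)%:C%C * (circle t - circle t') +
  (s - s')%:C%C * (a - (r - rho)%:C%C * circle t')); last first.
  by rewrite /circle_homotopy /rcircle !rmorphD !rmorphM !rmorphN rmorph1; ring.
apply: le_trans (le_normcD _ _) _; rewrite !normcM !normc_real.
have A1 : `|(1 - s) * r + s * rho| <= r.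
  rewrite ger0_norm; last by rewrite addr_ge0 ?mulr_ge0 // ltW.
  by have := ler_wpM2l s0 rho_r; lra.
have A2 : normc (a - (r - rho)%:C%C * circle t') <= 2 * r.
  apply: le_trans (normcB _ _) _; rewrite normcM normc_circle normc_real mulr1.
  by rewrite ger0_norm ?subr_ge0 //; have := ltW rho0; lra.
have A3 := circle_lipschitz t t'.
have B1 := ler_pM (normr_ge0 _) (normc_ge0 _) A1 A3.
have B2 := ler_wpM2l (normr_ge0 (s - s')) A2.
have p0 := pi_ge0 R.
have C1 : 0 <= 4 * pi * r * `|s - s'| by rewrite !mulr_ge0.
have C2 : 0 <= 2 * r * `|t - t'| by rewrite !mulr_ge0.
apply: le_trans (lerD B1 B2) _; rewrite -subr_ge0.
rewrite (_ : _ - _ = 4 * pi * r * `|s - s'| + 2 * r * `|t - t'|); first exact: addr_ge0.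
by ring.
Qed.
End Homotopy.

(** The circles close up, so the sides t = 0 and t = 1 of the homotopy square cancel and [goursat]
    makes the sums over the two circles asymptotically equal. On the small circle f is nearly f a,
    and the constant part is evaluated exactly by [trap_circle_inv]. *)
Lemma cauchy_trap f a r : cdrv_on f r -> normc a < r -> forall e, 0 < e ->
  exists N, forall n, (N <= n)%N ->
    normc (trap (fun z => f z / (z - a)) (rcircle r) n 0 1 -
           f a * ('i%C * (kappa R n)%:C%C)) < e.
Proof.
move=> fr ar e e0; have p0 := pi_gt0 R.
have [la fa] := fr a (ltW ar).
(* Divided by rho and multiplied by the length bound 4 pi rho, this tolerance becomes e / 2; the
   other half of e goes to [goursat]. *)
have [d [d0 dP]] : exists d, 0 < d /\ forall z, normc (z - a) < d ->
    normc (f z - f a) <= e / (8 * pi).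
  by apply: cdrv_continuous fa _ _; rewrite divr_gt0 ?mulr_gt0.
pose rho := Num.min (d / 2) (r - normc a).
have rho0 : 0 < rho by rewrite lt_min divr_gt0 //= subr_gt0.
have rhod : rho < d by rewrite gt_min ltr_pdivrMr // ltr_pMr // ltrDl ltr01.
have arho : normc a + rho <= r by rewrite addrC -lerBrDr ge_min lexx orbT.
have r0 : 0 <= r by exact: le_trans (normc_ge0 a) (ltW ar).
pose q z := f z / (z - a).
pose g := circle_homotopy a r rho.
have e20 : 0 < e / 2 by rewrite divr_gt0.
have qg s t : 0 <= s <= 1 -> 0 <= t <= 1 -> exists l, cdrv q (g s t) l.
  move=> s01 _; have [l fl] := fr _ (circle_homotopy_le rho0 arho t s01).
  eexists; apply: cdrvM; first exact: fl.
  apply: cdrvV; first by apply: cdrvB; [exact: cdrv_id|exact: cdrv_cst].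
  by rewrite -normc_gt0; apply: lt_le_trans rho0 (circle_homotopy_ge rho0 arho t s01).
have K0 : 0 <= 4 * pi * r + 2 * r by rewrite addr_ge0 ?mulr_ge0 // ltW.
have gL s t s' t' : 0 <= s <= 1 -> 0 <= t <= 1 -> 0 <= s' <= 1 -> 0 <= t' <= 1 ->
    normc (g s t - g s' t') <= (4 * pi * r + 2 * r) * (`|s - s'| + `|t - t'|).
  by move=> s01 _ _ _; exact: circle_homotopy_lipschitz.
have [N NP] := goursat K0 qg gL e20.
exists N => n Nn.
have t01 : trap q (g ^~ (0 + 1)) n 0 1 = trap q (g ^~ 0) n 0 1.
  apply: eq_trap => // t _.
  by rewrite /g /circle_homotopy /rcircle add0r circle1 circle0.
have g1 t : g (0 + 1) t = a + rcircle rho t.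
  by rewrite /g /circle_homotopy add0r subrr !mul1r mul0r add0r.
have g0 t : g 0 t = rcircle r t.
  by rewrite /g /circle_homotopy subr0 mul1r mul0r addr0.
have tg1 : trap q (g (0 + 1)) n 0 1 = trap q (fun t => a + rcircle rho t) n 0 1.
  by apply: eq_trap => // t _; rewrite g1.
have tg0 : trap q (g 0) n 0 1 = trap q (rcircle r) n 0 1.
  by apply: eq_trap => // t _; rewrite g0.
have tq : trap q (fun t => a + rcircle rho t) n 0 1 =
    trap (fun z => (f z - f a) / (z - a)) (fun t => a + rcircle rho t) n 0 1 +
    f a * ('i%C * (kappa R n)%:C%C).
  rewrite /kappa -[2 * pi]mulr1 -(trap_circle_inv a n 0 1 rho0) -trapZ -trapD.
  by congr trap; apply/funext => z; rewrite -mulrDl subrK.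
have rho0' := ltW rho0.
have small : normc (trap (fun z => (f z - f a) / (z - a)) (fun t => a + rcircle rho t) n 0 1)
    <= e / (8 * pi) / rho * (4 * pi * rho) * 1.
  apply: trap_bound => // [|t _|t t' _ _].
  - by rewrite !divr_ge0 ?mulr_ge0 // ltW.
  - rewrite [_ - a]addrC addKr normcM normcV normc_rcircle // ler_pM2r ?invr_gt0 //.
    by apply: dP; rewrite addrC addKr normc_rcircle // ltW.
  rewrite opprD addrACA subrr add0r /rcircle -mulrBr normcM normc_real ger0_norm //.
  by rewrite -mulrA mulrCA ler_pM2l // circle_lipschitz.
have := NP n Nn; rewrite /bd t01 [trap q (g ^~ 0) _ _ _ + _]addrC addrK tg1 tg0 tq => bdn.
have -> : e = e / 2 + e / (8 * pi) / rho * (4 * pi * rho) * 1.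
  by move: pi p0 => p p_gt0; field; rewrite (gt_eqF rho0) (gt_eqF p_gt0).
have split3 (S F T : C) (x y : R) : normc (S + F - T) < x -> normc S <= y ->
    normc (T - F) < x + y.
  move=> sx sy; rewrite (_ : T - F = S - (S + F - T)); last by ring.
  by apply: le_lt_trans (normcB _ _) _; rewrite addrC; exact: ltr_leD.
exact: split3 bdn small.
Qed.
End CauchyFormula.

(** * Limits of complex sequences *)

Section Limits.
Variable R : realType.
Local Notation C := (R[i]).
Implicit Types (x y : nat -> C) (l k z : C) (e B : R).

Definition tends x l := forall e, 0 < e ->
  exists N, forall n, (N <= n)%N -> normc (x n - l) < e.

Lemma tendsB x y l k : tends x l -> tends y k -> tends (fun n => x n - y n) (l - k).
Proof.
move=> xl yk e e0; have e20 : 0 < e / 2 by rewrite divr_gt0.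
have [N NP] := xl _ e20; have [N' N'P] := yk _ e20.
exists (maxn N N') => n; rewrite geq_max => /andP[/NP + /N'P].
rewrite (_ : x n - y n - (l - k) = x n - l - (y n - k)); last by ring.
by move=> ? ?; apply: le_lt_trans (normcB _ _) _; lra.
Qed.

Lemma tendsZ k x l : tends x l -> tends (fun n => k * x n) (k * l).
Proof.
move=> xl e e0; have k0 : 0 < normc k + 1 by rewrite ltr_wpDl ?normc_ge0.
have [N NP] := xl (e / (normc k + 1)) (divr_gt0 e0 k0).
exists N => n /NP; rewrite ltr_pdivlMr // -mulrBr normcM mulrC; apply: le_lt_trans.
by rewrite ler_wpM2r ?normc_ge0 // lerDl.
Qed.

Lemma tends_le x l B N : tends x l -> (forall n, (N <= n)%N -> normc (x n) <= B) ->
  normc l <= B.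
Proof.
move=> xl xB; apply/ler_addgt0Pl => e e0; have [N' N'P] := xl _ e0.
have h1 := N'P _ (leq_maxr N N'); have h2 := xB _ (leq_maxl N N').
have := ler_distc l (x (maxn N N')); rewrite normc_sym; lra.
Qed.

(** Completeness in a form where every e may come with its own centre c, which suits approximation
    by difference quotients. The limit is the supremum of the eventual lower bounds of [y]. *)
Lemma real_complete (y : nat -> R) : (forall e, 0 < e ->
    exists c N, forall n, (N <= n)%N -> `|y n - c| <= e) ->
  exists l : R, forall e, 0 < e -> exists N, forall n, (N <= n)%N -> `|y n - l| <= e.
Proof.
move=> yc; pose S := [set t | exists N, forall n, (N <= n)%N -> t <= y n]%classic.
have SP e : 0 < e -> exists c, [/\ S (c - e), (forall t, S t -> t <= c + e) &
    exists N, forall n, (N <= n)%N -> `|y n - c| <= e].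
  move=> /yc[c [N NP]]; exists c; split; last by exists N.
  - by exists N => n /NP; rewrite ler_norml; lra.
  - move=> t [N' N'P]; have := NP _ (leq_maxl N N'); have := N'P _ (leq_maxr N N').
    by rewrite ler_norml; lra.
exists (sup S) => e e0; have e20 : 0 < e / 2 by rewrite divr_gt0.
have [c [Sc Sub [N NP]]] := SP _ e20; exists N => n /NP.
have := ub_le_sup (ex_intro _ (c + e / 2) Sub) Sc.
have : sup S <= c + e / 2 by apply: ge_sup => //; exists (c - e / 2).
by rewrite !ler_norml; lra.
Qed.

Lemma Re_abs z : `|complex.Re z| <= normc z.
Proof. by rewrite -lecR; exact: normc_ge_Re. Qed.

Lemma Im_abs z : `|complex.Im z| <= normc z.
Proof.
have -> : complex.Im z = - complex.Re (z * 'i%C) by rewrite ReiNIm opprK.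
apply: le_trans (_ : _ <= normc (z * 'i%C)) _; first by rewrite normrN Re_abs.
by rewrite normcM /= expr0n expr1n add0r sqrtr1 mulr1.
Qed.

Lemma normc_le_ReIm z : normc z <= `|complex.Re z| + `|complex.Im z|.
Proof.
rewrite {1}[z]complexE; apply: le_trans (le_normcD _ _) _.
by rewrite normcM !normc_real /= expr0n expr1n add0r sqrtr1 mul1r.
Qed.

Lemma complex_complete x : (forall e, 0 < e ->
    exists c N, forall n, (N <= n)%N -> normc (x n - c) <= e) ->
  exists l, tends x l.
Proof.
move=> xc.
have [a aP] : exists l : R, forall e, 0 < e ->
    exists N, forall n, (N <= n)%N -> `|complex.Re (x n) - l| <= e.
  apply: real_complete => e /xc[c [N NP]]; exists (complex.Re c), N => n /NP.
  by apply: le_trans; rewrite -ReN -ReD Re_abs.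
have [b bP] : exists l : R, forall e, 0 < e ->
    exists N, forall n, (N <= n)%N -> `|complex.Im (x n) - l| <= e.
  apply: real_complete => e /xc[c [N NP]]; exists (complex.Im c), N => n /NP.
  apply: le_trans; apply: le_trans (Im_abs _).
  by case: (x n) => ? ?; case: (c) => ? ?.
exists (a +i* b)%C => e e0; have e30 : 0 < e / 3 by rewrite divr_gt0.
have [N NP] := aP _ e30; have [N' N'P] := bP _ e30.
exists (maxn N N') => n; rewrite geq_max => /andP[/NP + /N'P].
move=> h1 h2; apply: le_lt_trans (normc_le_ReIm _) _.
have -> : complex.Re (x n - (a +i* b)%C) = complex.Re (x n) - a by case: (x n).
have -> : complex.Im (x n - (a +i* b)%C) = complex.Im (x n) - b by case: (x n).
lra.
Qed.
End Limits.

(** * Discretized Cauchy integrals and the maximum principle *)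

Section CauchyMeans.
Variable R : realType.
Local Notation C := (R[i]).
Implicit Types (f phi psi : C -> C) (a b z l : C) (r d e M B : R) (n : nat).

(* Discretized Cauchy integral (2 i pi)^-1 \oint_(|z| = r) f(z) phi(z) dz. *)
Definition cmean f r phi n : C :=
  trap (fun z => f z * phi z) (rcircle r) n 0 1 / ('i%C * (kappa R n)%:C%C).

Lemma cmeanB f r phi psi n :
  cmean f r (fun z => phi z - psi z) n = cmean f r phi n - cmean f r psi n.
Proof.
rewrite /cmean -mulrBl -trapB; congr (trap _ _ _ _ _ / _).
by apply/funext => z; rewrite mulrBr.
Qed.

Lemma cmeanZ k f r phi n : cmean f r (fun z => k * phi z) n = k * cmean f r phi n.
Proof.
rewrite /cmean mulrA -trapZ; congr (trap _ _ _ _ _ / _).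
by apply/funext => z; rewrite mulrCA.
Qed.

Lemma eq_cmean f r phi psi n : 0 <= r -> (forall z, normc z = r -> phi z = psi z) ->
  cmean f r phi n = cmean f r psi n.
Proof.
move=> r0 E; congr (_ / _); apply: eq_trap => // t _; split => //.
by rewrite E // normc_rcircle.
Qed.

Lemma normc_ikappa n : (2 <= n)%N -> 4 <= normc ('i%C * (kappa R n)%:C%C).
Proof.
move=> /(kappa_ge4 R) k4; rewrite normcM normc_real ger0_norm; last by lra.
by rewrite /= expr0n expr1n add0r sqrtr1 mul1r.
Qed.

(** The factor pi * r is the length bound 4 pi r divided by the lower bound 4 for [kappa n]. *)
Lemma cmean_bound f r phi M B n : 0 <= r -> 0 <= M -> 0 <= B -> (2 <= n)%N ->
  (forall t, 0 <= t <= 1 -> normc (f (rcircle r t)) <= M) ->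
  (forall z, normc z = r -> normc (phi z) <= B) ->
  normc (cmean f r phi n) <= M * B * (pi * r).
Proof.
move=> r0 M0 B0 n2 fM phiB; have k4 := normc_ikappa n2.
have k0 : 0 < normc ('i%C * (kappa R n)%:C%C) by exact: lt_le_trans k4.
rewrite normcM normcV ler_pdivrMr //.
apply: (@le_trans _ _ (M * B * (4 * pi * r) * 1)).
  apply: trap_bound => // [|t|t t' _ _]; first exact: mulr_ge0.
    rewrite add0r => t01; rewrite normcM ler_pM ?normc_ge0 ?fM //.
    by rewrite phiB // normc_rcircle.
  rewrite /rcircle -mulrBr normcM normc_real ger0_norm // mulrAC mulrC.
  by rewrite ler_wpM2r // circle_lipschitz.
rewrite mulr1 -[4 * pi * r]mulrA [4 * (_ * _)]mulrC [leLHS]mulrA ler_wpM2l //.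
by rewrite !mulr_ge0 ?pi_ge0.
Qed.

Lemma cmean_cauchy f r a : cdrv_on f r -> normc a < r ->
  tends (cmean f r (fun z => (z - a)^-1)) (f a).
Proof.
move=> fr ar e e0; have [N NP] := cauchy_trap fr ar e0.
exists (maxn N 2) => n; rewrite geq_max => /andP[/NP nP n2].
have k4 := normc_ikappa n2.
have k0 : 0 < normc ('i%C * (kappa R n)%:C%C) by exact: lt_le_trans k4.
have k0' : 'i%C * (kappa R n)%:C%C != 0 :> C by rewrite -normc_gt0.
rewrite -[f a](mulfK k0') /cmean -mulrBl normcM normcV ltr_pdivrMr //.
apply: lt_le_trans nP _; rewrite ler_peMr ?ltW //; lra.
Qed.

Lemma cdrv_on_bounded f r : 0 <= r -> cdrv_on f r ->
  exists M, 0 <= M /\ forall t, 0 <= t <= 1 -> normc (f (rcircle r t)) <= M.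
Proof.
move=> r0 fr; pose phi t := normc (f (rcircle r t)).
have phic : continuous phi.
  move=> t; apply/cvgrPdist_le => e e0.
  have [l fl] : exists l, cdrv f (rcircle r t) l by apply: fr; rewrite normc_rcircle.
  have [d [d0 dP]] := cdrv_continuous fl e0.
  have L0 : 0 < 4 * pi * r + 1 by rewrite ltr_wpDl ?mulr_ge0 ?pi_ge0.
  near=> s; apply: (@le_trans _ _ (normc (f (rcircle r s) - f (rcircle r t)))).
    by rewrite normc_sym normc_dist.
  apply: dP; rewrite /rcircle -mulrBr normcM normc_real ger0_norm //.
  apply: (@le_lt_trans _ _ ((4 * pi * r + 1) * `|s - t|)).
    have := ler_wpM2l r0 (circle_lipschitz s t); have := normr_ge0 (s - t); lra.
  rewrite mulrC -ltr_pdivlMr // distrC; near: s.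
  by apply: (@cvgr_dist_lt _ R^o _ _ _ id) => //; rewrite divr_gt0.
have [c _ cP] := EVT_max ler01 (continuous_subspaceT phic).
exists (phi c); split => [|t t01]; first exact: normc_ge0.
by apply: (cP t); rewrite in_itv.
Unshelve. all: by end_near. Qed.

Lemma bernoulli_le (x : R) m : 0 <= x -> 1 + m%:R * (x - 1) <= x ^+ m.
Proof.
move=> x0; elim: m => [|m IH]; first by rewrite mul0r addr0 expr0.
rewrite exprS; apply: le_trans (ler_wpM2l x0 IH).
have : 0 <= m%:R * (x - 1) ^+ 2 by rewrite mulr_ge0 ?sqr_ge0.
rewrite -subr_ge0 => h; rewrite -subr_ge0.
by rewrite (_ : _ - _ = m%:R * (x - 1) ^+ 2) //; last by rewrite -natr1; ring.
Qed.

Lemma pow_bounded_le (x y c : R) : 0 <= x -> 0 <= y ->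
  (forall m, x ^+ m <= y ^+ m * c) -> x <= y.
Proof.
move=> x0 y0 xy; rewrite leNgt; apply/negP => yx.
have [y_eq0|yn0] := eqVneq y 0.
  by have := xy 1%N; rewrite y_eq0 !expr1 mul0r; lra.
have y_gt0 : 0 < y by rewrite lt0r yn0.
have u1 : 0 < x / y - 1 by rewrite subr_gt0 ltr_pdivlMr // mul1r.
pose m := Num.bound `|c / (x / y - 1)|.
have : (x / y) ^+ m <= c by rewrite expr_div_n ler_pdivrMr ?exprn_gt0 // mulrC.
have := bernoulli_le m (divr_ge0 x0 y0).
have : c < m%:R * (x / y - 1).
  rewrite -ltr_pdivrMr //; by apply: le_lt_trans (ler_norm _) _; apply: archi_boundP.
lra.
Qed.

(* Cauchy's formula bounds |f a| ^ m by M ^ m up to a factor independent of m. *)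
Lemma max_modulus f r a M : cdrv_on f r -> normc a < r ->
  (forall z, normc z = r -> normc (f z) <= M) -> normc (f a) <= M.
Proof.
move=> fr ar fM; have r0 : 0 <= r := le_trans (normc_ge0 a) (ltW ar).
have M0 : 0 <= M.
  by apply: le_trans (normc_ge0 _) (fM (rcircle r 0) _); rewrite normc_rcircle.
have B0 : 0 <= (r - normc a)^-1 by rewrite invr_ge0 subr_ge0 ltW.
apply: (@pow_bounded_le _ _ ((r - normc a)^-1 * (pi * r))) => // [|m].
  exact: normc_ge0.
rewrite -normcX mulrA.
have fmr : cdrv_on (fun z => f z ^+ m) r.
  by move=> z /fr[l fl]; eexists; apply: cdrvX; exact: fl.
apply: (tends_le (N := 2) (cmean_cauchy fmr ar)) => n n2.
apply: cmean_bound => // [|t _|z zr]; first exact: exprn_ge0.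
  by rewrite normcX; apply: lerXn2r; rewrite ?nnegrE ?normc_ge0 // fM // normc_rcircle.
rewrite normcV lef_pV2 ?posrE ?subr_gt0 //; first by rewrite -zr ler_distc.
by apply: lt_le_trans (ler_distc _ _); rewrite zr subr_gt0.
Qed.
End CauchyMeans.

(** * Differentiability of the derivative and removable singularities *)

Section Differentiation.
Variable R : realType.
Local Notation C := (R[i]).
Implicit Types (f G psi : C -> C) (phi : C -> C -> C) (a b z l : C).
Implicit Types (r d e M B : R) (n : nat).

(** Differentiation under the mean: [psi] is the derivative of the kernel [phi] in its parameter at
    a, with a quadratic remainder uniform on the circle. Convergence of the means of [psi] is part
    of the conclusion. *)
Lemma cmean_derive f r phi psi a B d G : 0 <= r -> cdrv_on f r -> 0 < d -> 0 <= B ->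
  (forall b z, normc (b - a) < d -> normc z = r ->
    normc (phi b z - phi a z - (b - a) * psi z) <= B * normc (b - a) ^+ 2) ->
  (forall b, normc (b - a) < d -> tends (cmean f r (phi b)) (G b)) ->
  exists l, tends (cmean f r psi) l /\ cdrv G a l.
Proof.
move=> r0 fr d0 B0 phiP phiG.
have [M [M0 fM]] := cdrv_on_bounded r0 fr.
pose D := M * B * (pi * r).
have D0 : 0 <= D by rewrite !mulr_ge0 ?pi_ge0.
have Ga : tends (cmean f r (phi a)) (G a) by apply: phiG; rewrite subrr normc0.
have rem b n : (2 <= n)%N -> normc (b - a) < d ->
    normc (cmean f r (phi b) n - cmean f r (phi a) n - (b - a) * cmean f r psi n)
      <= D * normc (b - a) ^+ 2.
  move=> n2 bd; rewrite -cmeanZ -2!cmeanB /D mulrAC -[M * B * _]mulrA.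
  apply: cmean_bound => //; first by rewrite mulr_ge0 ?sqr_ge0.
  by move=> z zr; exact: phiP.
(* For a fixed step h the means of [psi] end up within about D h of the difference quotient of [G];
   [h] is chosen so that D h takes at most half of e. *)
have [l lP] : exists l, tends (cmean f r psi) l.
  apply: complex_complete => e e0.
  have D1 : 0 < D + 1 by rewrite ltr_wpDl.
  pose h := Num.min (d / 2) (e / (2 * (D + 1))).
  have h0 : 0 < h by rewrite lt_min !divr_gt0 // mulr_gt0.
  have hd : h < d by rewrite gt_min ltr_pdivrMr // ltr_pMr // ltrDl ltr01.
  have Dh : D * h <= e / 2.
    have : h <= e / (2 * (D + 1)) by rewrite ge_min lexx orbT.
    rewrite ler_pdivlMr ?mulr_gt0 // => ?; rewrite ler_pdivlMr //; lra.
  pose b : C := a + h%:C%C.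
  have ba : b - a = h%:C%C by rewrite /b addrC addKr.
  have nba : normc (b - a) = h by rewrite ba normc_real ger0_norm // ltW.
  have bd : normc (b - a) < d by rewrite nba.
  have [N NP] := tendsB (phiG b bd) Ga (mulr_gt0 h0 (divr_gt0 e0 (ltr0n _ 2))).
  exists ((G b - G a) / (b - a)), (maxn N 2) => n.
  rewrite geq_max => /andP[/NP nP n2].
  have := rem b n n2 bd.
  have ba0 : b - a != 0 by rewrite -normc_gt0 nba.
  set P := cmean f r psi n in nP *; set Q := _ - cmean _ _ (phi a) n in nP *.
  have -> : P - (G b - G a) / (b - a) =
      (Q - (G b - G a) - (Q - (b - a) * P)) / (b - a) by field.
  rewrite normcM normcV nba => Pn; rewrite ler_pdivrMr //.
  apply: le_trans (normcB _ _) _.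
  have := ler_wpM2r (ltW h0) Dh; move: nP Pn; rewrite expr2.
  by set x := normc (Q - _); set y := normc (Q - _); lra.
exists l; split => //; apply/cdrvP => e e0.
have D1 : 0 < D + 1 by rewrite ltr_wpDl.
exists (Num.min d (e / (D + 1))); split; first by rewrite lt_min d0 divr_gt0.
move=> b; rewrite lt_min => /andP[bd be].
have T := tendsB (tendsB (phiG b bd) Ga) (tendsZ (b - a) lP).
rewrite [l * _]mulrC; apply: (tends_le (N := 2) T) => n n2.
apply: le_trans (rem b n n2 bd) _.
rewrite expr2 mulrA ler_wpM2r ?normc_ge0 //.
move: be; rewrite ltr_pdivlMr // => be.
have := normc_ge0 (b - a); lra.
Qed.

Section Kernels.
Variables (a : C) (r : R).
Hypothesis ar : normc a < r.
Let d := (r - normc a) / 2.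

Lemma kernel_gap_gt0 : 0 < d.
Proof. by rewrite divr_gt0 // subr_gt0. Qed.

Lemma kernel_gap b z : normc (b - a) < d -> normc z = r -> d <= normc (z - b).
Proof.
move=> bd zr; have := ler_distc z b; have := ler_distc b a.
by rewrite /d in bd *; rewrite zr; lra.
Qed.

Lemma kernel_gap_neq0 b z : normc (b - a) < d -> normc z = r -> z - b != 0.
Proof.
by move=> bd zr; rewrite -normc_gt0; apply: lt_le_trans kernel_gap_gt0 (kernel_gap bd zr).
Qed.

Lemma kernel_gapV b z : normc (b - a) < d -> normc z = r -> normc (z - b)^-1 <= d^-1.
Proof.
move=> bd zr; have d0 := kernel_gap_gt0; have h := kernel_gap bd zr.
by rewrite normcV lef_pV2 ?posrE //; exact: lt_le_trans h.
Qed.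
Let a0 : normc (a - a) < d.
Proof. by rewrite subrr normc0 kernel_gap_gt0. Qed.

Lemma kernel1_expand b z : normc (b - a) < d -> normc z = r ->
  normc ((z - b)^-1 - (z - a)^-1 - (b - a) * (z - a)^-1 ^+ 2) <=
    d^-1 ^+ 3 * normc (b - a) ^+ 2.
Proof.
move=> bd zr; have zb := kernel_gap_neq0 bd zr; have za := kernel_gap_neq0 a0 zr.
have -> : (z - b)^-1 - (z - a)^-1 - (b - a) * (z - a)^-1 ^+ 2 =
    (z - b)^-1 * (z - a)^-1 * (z - a)^-1 * (b - a) ^+ 2 by field; rewrite za zb.
have kb := kernel_gapV bd zr; have ka := kernel_gapV a0 zr.
rewrite normcM normcX ler_wpM2r ?sqr_ge0 // !normcM exprSr expr2.
by rewrite !ler_pM ?mulr_ge0 ?normc_ge0.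
Qed.

(** The remainder is a sum of three products, each of four kernel factors of modulus at most 1 /
    d. *)
Lemma kernel2_expand b z : normc (b - a) < d -> normc z = r ->
  normc ((z - b)^-1 ^+ 2 - (z - a)^-1 ^+ 2 - (b - a) * (2 * (z - a)^-1 ^+ 3)) <=
    (d^-1 ^+ 4 *+ 3) * normc (b - a) ^+ 2.
Proof.
move=> bd zr; have zb := kernel_gap_neq0 bd zr; have za := kernel_gap_neq0 a0 zr.
have -> : (z - b)^-1 ^+ 2 - (z - a)^-1 ^+ 2 - (b - a) * (2 * (z - a)^-1 ^+ 3) =
    ((z - b)^-1 ^+ 2 * (z - a)^-1 ^+ 2 + (z - b)^-1 * (z - a)^-1 ^+ 3 +
     (z - b)^-1 * (z - a)^-1 ^+ 3) * (b - a) ^+ 2 by field; rewrite za zb.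
have kb := kernel_gapV bd zr; have ka := kernel_gapV a0 zr.
rewrite normcM normcX ler_wpM2r ?sqr_ge0 //.
have d1 : 0 <= d^-1 by rewrite invr_ge0 ltW // kernel_gap_gt0.
have k2b : normc (z - b)^-1 ^+ 2 <= d^-1 ^+ 2 by apply: lerXn2r; rewrite ?nnegrE ?normc_ge0.
have k2a : normc (z - a)^-1 ^+ 2 <= d^-1 ^+ 2 by apply: lerXn2r; rewrite ?nnegrE ?normc_ge0.
have k3a : normc (z - a)^-1 ^+ 3 <= d^-1 ^+ 3 by apply: lerXn2r; rewrite ?nnegrE ?normc_ge0.
apply: le_trans (normcD3 _ _ _) _.
have nM (u v : C) i j : normc (u ^+ i * v ^+ j) = normc u ^+ i * normc v ^+ j.
  by rewrite normcM !normcX.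
rewrite nM -[in X in _ + X <= _](expr1 (z - b)^-1) nM.
have -> : d^-1 ^+ 4 *+ 3 =
    d^-1 ^+ 2 * d^-1 ^+ 2 + d^-1 * d^-1 ^+ 3 + d^-1 * d^-1 ^+ 3.
  by move: d^-1 => c; ring.
by rewrite !lerD // ler_pM ?exprn_ge0 ?normc_ge0.
Qed.

Lemma cdrv_cmean f : cdrv_on f r -> exists l,
  tends (cmean f r (fun z => (z - a)^-1 ^+ 2)) l /\ cdrv f a l.
Proof.
move=> fr; have r0 : 0 <= r := le_trans (normc_ge0 a) (ltW ar).
apply: (cmean_derive (phi := fun b z => (z - b)^-1) (B := d^-1 ^+ 3) (d := d)) => //.
- exact: kernel_gap_gt0.
- by rewrite exprn_ge0 // invr_ge0 ltW // kernel_gap_gt0.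
- by move=> b z; exact: kernel1_expand.
move=> b bd; apply: cmean_cauchy => //.
have := ler_distc b a; rewrite /d in bd; move: ar; lra.
Qed.
End Kernels.

Lemma tends_cderiv f r a : cdrv_on f r -> normc a < r ->
  tends (cmean f r (fun z => (z - a)^-1 ^+ 2)) (cderiv f a).
Proof. by move=> fr ar; have [l [tl /cderiv_cdrv ->]] := cdrv_cmean ar fr. Qed.

(** Near a the derivative is itself a limit of means, with kernel (z - b) ^ -2, so it can be
    differentiated once more under the mean. *)
Lemma cdrv_cderiv_twice f r a : cdrv_on f r -> normc a < r ->
  exists l, cdrv (cderiv f) a l.
Proof.
move=> fr ar; have r0 : 0 <= r := le_trans (normc_ge0 a) (ltW ar).
have d0 := kernel_gap_gt0 ar; set d := (r - normc a) / 2 in d0.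
have B0 : 0 <= d^-1 ^+ 4 *+ 3 by rewrite mulrn_wge0 // exprn_ge0 // invr_ge0 ltW.
suff [l [_ gl]] : exists l, tends (cmean f r (fun z => 2 * (z - a)^-1 ^+ 3)) l /\
    cdrv (cderiv f) a l by exists l.
apply: (cmean_derive (phi := fun b z => (z - b)^-1 ^+ 2) r0 fr d0 B0).
  by move=> b z; exact: kernel2_expand.
move=> b bd; apply: tends_cderiv => //.
have := ler_distc b a; rewrite /d in bd; lra.
Qed.

(** The difference quotient at 0 with its singularity filled in; it replaces the coefficient shift
    of a power series. *)
Definition dquot f z : C := if z == 0 then cderiv f 0 else (f z - f 0) / z.

Lemma dquot0 f : dquot f 0 = cderiv f 0.
Proof. by rewrite /dquot eqxx. Qed.

Lemma dquot_neq0 f z : z != 0 -> dquot f z = (f z - f 0) / z.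
Proof. by move=> /negPf z0; rewrite /dquot z0. Qed.

Lemma dquotE f z : f z = f 0 + z * dquot f z.
Proof.
have [->|z0] := eqVneq z 0; first by rewrite mul0r addr0.
by rewrite dquot_neq0 // mulrC divfK // addrC subrK.
Qed.

(** By partial fractions (1 / (z - b) - 1 / z) / b = 1 / (z (z - b)). Thus [dquot f b] is the limit
    of the means with this kernel, and at b = 0 the kernel z ^ -2 yields the derivative, so
    [cmean_derive] applies. *)
Lemma cdrv_dquot0 f r : 0 < r -> cdrv_on f r -> exists l, cdrv (dquot f) 0 l.
Proof.
move=> r0 fr; have ar : normc (0 : C) < r by rewrite normc0.
have d0 := kernel_gap_gt0 ar; have := @kernel_gapV _ _ ar; have := @kernel_gap_neq0 _ _ ar.
set d := (r - _) / 2 in d0 * => gap_neq0 gapV.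
have B0 : 0 <= d^-1 ^+ 4 by rewrite exprn_ge0 // invr_ge0 ltW.
have zero_d : normc (0 - 0 : C) < d by rewrite subrr normc0.
suff [l [_ gl]] : exists l, tends (cmean f r (fun z => (z - 0)^-1 ^+ 3)) l /\
    cdrv (dquot f) 0 l by exists l.
apply: (cmean_derive (phi := fun b z => (z - 0)^-1 * (z - b)^-1) (ltW r0) fr d0 B0).
  move=> b z bd zr; have zb := gap_neq0 _ _ bd zr; have z0 := gap_neq0 _ _ zero_d zr.
    have -> : (z - 0)^-1 * (z - b)^-1 - (z - 0)^-1 * (z - 0)^-1 - (b - 0) * (z - 0)^-1 ^+ 3 =
        (z - b)^-1 * (z - 0)^-1 ^+ 3 * (b - 0) ^+ 2.
      by rewrite !subr0 in z0 *; field; rewrite z0 zb.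
    have kb := gapV _ _ bd zr; have k0 := gapV _ _ zero_d zr.
    rewrite normcM [normc ((b - 0) ^+ 2)]normcX ler_wpM2r ?sqr_ge0 //.
    rewrite normcM normcX [d^-1 ^+ 4]exprS.
    apply: ler_pM => //; rewrite ?exprn_ge0 ?normc_ge0 //.
    by apply: lerXn2r; rewrite ?nnegrE ?normc_ge0 // invr_ge0 ltW.
move=> b bd; have [->|b0] := eqVneq b 0.
  by rewrite dquot0; exact: tends_cderiv fr ar.
have br : normc b < r by rewrite subr0 in bd; move: bd; rewrite /d normc0; lra.
have := tendsZ b^-1 (tendsB (cmean_cauchy fr br) (cmean_cauchy fr ar)).
rewrite dquot_neq0 // [b^-1 * (_ - _)]mulrC => T e /T[N NP]; exists N => n /NP.
rewrite -cmeanB -cmeanZ (@eq_cmean _ _ _ _ (fun z => (z - 0)^-1 * (z - b)^-1)) //; first exact: ltW.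
move=> z zr; have zb := gap_neq0 _ _ bd zr; have z0 := gap_neq0 _ _ zero_d zr.
by rewrite !subr0 in z0 *; field; rewrite z0 zb b0.
Qed.

Lemma cdrv_dquot f r : 0 < r -> cdrv_on f r -> cdrv_on (dquot f) r.
Proof.
move=> r0 fr z zr; have [->|z0] := eqVneq z 0; first exact: cdrv_dquot0 r0 fr.
have [l fl] := fr z zr; eexists.
apply: (@cdrv_near _ (fun w => (f w - f 0) / w) _ _ _ (normc z)); first by rewrite normc_gt0.
  move=> w wz; rewrite dquot_neq0 //; apply: contraTneq wz => ->.
  by rewrite sub0r normcN ltxx.
apply: cdrvM; last by apply: cdrvV; [exact: cdrv_id|].
by apply: cdrvB; [exact: fl|exact: cdrv_cst].
Qed.
End Differentiation.

(** * The Schwarz-Pick bound *)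

Section RealPart.
Variable R : realType.
Local Notation C := (R[i]).
Local Open Scope classical_set_scope.
Implicit Types (a b z l w : C) (t : R) (Y : C -> C).

Lemma is_derive_Re_line Y z t l : cdrv Y (t%:C%C * z) l ->
  is_derive t 1 (fun s => complex.Re (Y (s%:C%C * z))) (complex.Re (z * l)).
Proof.
move=> /cdrvP Yl.
suff H : (fun h : R => h^-1 *: (complex.Re (Y ((h *: (1 : R) + t)%:C%C * z)) -
    complex.Re (Y (t%:C%C * z)))) @ 0^' --> complex.Re (z * l).
  by apply: DeriveDef; [exact: cvgP H|exact: cvg_lim H].
apply/cvgrPdist_le => e e0.
have z1 : 0 < normc z + 1 by rewrite ltr_wpDl ?normc_ge0.
have [d [d0 dP]] := Yl _ (divr_gt0 e0 z1).
rewrite /dnbhs near_withinE; apply/nbhs_ballP.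
exists (d / (normc z + 1)); first by rewrite /= divr_gt0.
move=> h; rewrite -ball_normE /= sub0r normrN ltr_pdivlMr // => hd h0.
have E : (h + t)%:C%C * z - t%:C%C * z = h%:C%C * z by rewrite rmorphD; ring.
have := dP ((h + t)%:C%C * z); rewrite E normcM normc_real.
have hz : `|h| * normc z <= `|h| * (normc z + 1) by rewrite ler_wpM2l // lerDl.
move=> /(_ (le_lt_trans hz hd)) => H.
have h_gt0 : 0 < `|h| by rewrite normr_gt0.
rewrite /GRing.scale /= mulr1 -(ler_pM2l h_gt0) -normrM mulrBr mulVKf //.
rewrite -ReZ -ReN -ReD -ReN -ReD.
apply: le_trans (Re_abs _) _.
rewrite normc_sym.
rewrite (_ : _ - _ = Y ((h + t)%:C%C * z) - Y (t%:C%C * z) - l * (h%:C%C * z)); last by ring.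
apply: le_trans H _; rewrite mulrCA ler_wpM2l //.
by rewrite mulrAC ler_pdivrMr // ler_pM2l // lerDl.
Qed.

(** Takes the place of integration along the segment from 0 to z: the mean value theorem for t -> Re
    (Y (t z)). *)
Lemma Re_line_le Y (dY : R -> C) z :
  (forall t, 0 <= t <= 1 -> cdrv Y (t%:C%C * z) (dY t)) ->
  (forall t, 0 <= t <= 1 -> complex.Re (z * dY t) <= 0) ->
  complex.Re (Y z) <= complex.Re (Y 0).
Proof.
move=> YP dY0; pose phi t := complex.Re (Y (t%:C%C * z)).
have phiP t : 0 <= t <= 1 -> is_derive t 1 phi (complex.Re (z * dY t)).
  by move=> t01; exact: is_derive_Re_line (YP t t01).
have [t||c c01 E] := @MVT_segment _ phi (fun t => complex.Re (z * dY t)) 0 1 ler01.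
- by rewrite in_itv /= => /andP[/ltW t0 /ltW t1]; apply: phiP; rewrite t0.
- apply: derivable_within_continuous => t; rewrite in_itv => /phiP[] //.
move: E; rewrite /phi mul0r mul1r subr0 mulr1 => E.
by rewrite -subr_le0 E dY0 // -in_itv.
Qed.
End RealPart.

Section SchwarzPick.
Variable R : realType.
Local Notation C := (R[i]).
Implicit Types (a b z l w : C) (f P : C -> C) (r x y : R).

Lemma sqr_normcD z w : normc (z + w) ^+ 2 =
  normc z ^+ 2 + normc w ^+ 2 +
  2 * (complex.Re z * complex.Re w + complex.Im z * complex.Im w).
Proof. by rewrite !normc_sqr; case: z => ? ?; case: w => ? ? /=; ring. Qed.

(** The squares differ by (1 - |b| ^ 2) (1 - |w| ^ 2). *)
Lemma normc_mobius b w : normc b <= 1 -> normc w <= 1 ->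
  normc (w - b) <= normc (1 - b^*%C * w).
Proof.
move=> b1 w1; suff : normc (w - b) ^+ 2 <= normc (1 - b^*%C * w) ^+ 2.
  by rewrite ler_pXn2r // nnegrE normc_ge0.
have b2 : normc b ^+ 2 <= 1 by rewrite exprn_ile1 ?normc_ge0.
have w2 : normc w ^+ 2 <= 1 by rewrite exprn_ile1 ?normc_ge0.
rewrite -subr_ge0 (_ : _ - _ = (1 - normc b ^+ 2) * (1 - normc w ^+ 2)).
  by rewrite mulr_ge0 ?subr_ge0.
by rewrite !normc_sqr; case: (b) => ? ?; case: (w) => ? ? /=; ring.
Qed.

(** The passage s -> 1 that ends the Schwarz-Pick argument, with y = |f z| ^ 2. *)
Lemma le_lim_scale x y : 0 <= x -> 0 <= y ->
  (forall s, 0 < s < 1 -> s * x <= 2 * (1 - s ^+ 2 * y)) -> x <= 2 * (1 - y).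
Proof.
move=> x0 y0 H; rewrite leNgt; apply/negP => xy.
have c0 : 0 < x - 2 * (1 - y) by rewrite subr_gt0.
have q0 : 0 < x + 4 * y + 1 by lra.
(* For s = 1 - e the assumed inequality differs from its limit by at most e (x + 4 y), less than the
   supposed gap. *)
pose e := Num.min (1 / 2) ((x - 2 * (1 - y)) / (x + 4 * y + 1)).
have e0 : 0 < e by rewrite lt_min !divr_gt0.
have e1 : e <= 1 / 2 by rewrite ge_min lexx.
have ec : e * (x + 4 * y + 1) <= x - 2 * (1 - y).
  by rewrite -ler_pdivlMr // ge_min lexx orbT.
have /H : 0 < 1 - e < 1 by lra.
have := mulr_ge0 (sqr_ge0 e) y0; rewrite !expr2; nra.
Qed.

Lemma le1_lim_scale x y : 0 <= y < 1 -> 0 <= x ->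
  (forall r, y < r < 1 -> r ^+ 2 * x <= 1) -> x <= 1.
Proof.
move=> /andP[y0 y1] x0 H; rewrite leNgt; apply/negP => x1.
have xV : x^-1 < 1 by rewrite invf_lt1 //; lra.
have xV0 : 0 < x^-1 by rewrite invr_gt0; lra.
(* [s] is the arithmetic mean of 1 and 1 / x, hence s ^ 2 > 1 / x; the maximum only ensures y <
   r. *)
pose s := (1 + x^-1) / 2; pose r := Num.max s ((1 + y) / 2).
have sr : s <= r by rewrite le_max lexx.
have r1 : r < 1 by rewrite gt_max /s; lra.
have ry : y < r by rewrite lt_max; apply/orP; right; lra.
have := H r; rewrite ry r1 => /(_ isT); apply/negP; rewrite -ltNge.
have s0 : 0 < s by rewrite /s; lra.
have : s ^+ 2 * x <= r ^+ 2 * x by rewrite ler_wpM2r // ler_pXn2r // nnegrE; lra.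
apply: lt_le_trans; rewrite -ltr_pdivrMr ?mul1r; last by lra.
by rewrite /s expr2; move: x^-1 xV => u u1; nra.
Qed.

Definition cdrv_in_disc f := forall z, normc z < 1 -> exists l, cdrv f z l.

Lemma cdrv_in_disc_on f r : cdrv_in_disc f -> r < 1 -> cdrv_on f r.
Proof. by move=> fd r1 z zr; apply: fd; exact: le_lt_trans r1. Qed.

Lemma cdrv_in_discP f : (forall r, 0 < r < 1 -> cdrv_on f r) -> cdrv_in_disc f.
Proof.
move=> fr z z1; apply: (fr ((1 + normc z) / 2)); have := normc_ge0 z; lra.
Qed.

Lemma cdrv_in_disc_cderiv f : cdrv_in_disc f -> cdrv_in_disc (cderiv f).
Proof.
move=> fd z z1; have zr : normc z < (1 + normc z) / 2 by lra.
by apply: cdrv_cderiv_twice zr; apply: cdrv_in_disc_on fd _; lra.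
Qed.

Lemma cdrv_in_disc_dquot f : cdrv_in_disc f -> cdrv_in_disc (dquot f).
Proof.
move=> fd; apply: cdrv_in_discP => r /andP[r0 r1].
by apply: cdrv_dquot => //; exact: cdrv_in_disc_on.
Qed.

Lemma cdrv_in_discE f z : cdrv_in_disc f -> normc z < 1 -> cdrv f z (cderiv f z).
Proof. by move=> fd /fd[l fl]; rewrite (cderiv_cdrv fl). Qed.

(** The disc of radius 1 / 2 about z lies in the unit disc. After a Moebius map sending the value at
    z to 0, the maximum principle for S w / w on |w| = 1 / 2 gives |S' 0| <= 2, which is where the
    constant comes from. *)
Lemma schwarz_pick f z : cdrv_in_disc f -> (forall w, normc w < 1 -> normc (f w) <= 1) ->
  normc z < 1 / 2 -> normc (cderiv f z) <= 2 * (1 - normc (f z) ^+ 2).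
Proof.
move=> fd f1 z12; have fz1 : normc (f z) <= 1 by apply: f1; lra.
have fz2 : normc (f z) ^+ 2 <= 1 by rewrite exprn_ile1 ?normc_ge0.
apply: le_lim_scale => [||s s01]; rewrite ?normc_ge0 ?sqr_ge0 //.
(* Since |f| <= 1 is not strict, f is scaled by s < 1 to keep the Moebius denominator away from
   0. *)
pose b := s%:C%C * f z; pose g w := s%:C%C * f (z + w).
have snorm w : normc w <= 1 -> normc (s%:C%C * w) <= s.
  move=> w1; rewrite normcM normc_real ger0_norm; last by lra.
  by rewrite ler_piMr //; lra.
have bs : normc b <= s by exact: snorm.
have zw1 w : normc w <= 1 / 2 -> normc (z + w) < 1.
  by move=> w2; apply: le_lt_trans (le_normcD _ _) _; lra.
have gs w : normc w <= 1 / 2 -> normc (g w) <= s by move=> /zw1 ?; apply/snorm/f1.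
have den w : normc w <= 1 / 2 -> 1 - b^*%C * g w != 0.
  move=> /gs gw; rewrite -normc_gt0.
  apply: lt_le_trans (ler_distc _ _); rewrite normc1 normcM normc_conj subr_gt0.
  have : normc b * normc (g w) <= s * s by rewrite ler_pM ?normc_ge0.
  by nra.
pose S w := (g w - b) / (1 - b^*%C * g w).
have gd w : normc w <= 1 / 2 -> cdrv g w (s%:C%C * cderiv f (z + w)).
  move=> /zw1 w1; have := cdrvM (cdrv_cst s%:C%C w) (cdrv_shift (cdrv_in_discE fd w1)).
  by move=> /cdrv_eq; apply; rewrite mulr0 addr0.
have gbd w : normc w <= 1 / 2 -> cdrv (fun w => g w - b) w (s%:C%C * cderiv f (z + w) - 0).
  by move=> w2; apply: cdrvB; [exact: gd|exact: cdrv_cst].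
have dend w : normc w <= 1 / 2 ->
    cdrv (fun w => 1 - b^*%C * g w) w (0 - (b^*%C * (s%:C%C * cderiv f (z + w)) + g w * 0)).
  by move=> w2; apply: cdrvB; [exact: cdrv_cst|apply: cdrvM; [exact: cdrv_cst|exact: gd]].
have Sd w : normc w <= 1 / 2 -> cdrv S w
    ((g w - b) * (- (0 - (b^*%C * (s%:C%C * cderiv f (z + w)) + g w * 0)) /
       (1 - b^*%C * g w) ^+ 2) +
     (1 - b^*%C * g w)^-1 * (s%:C%C * cderiv f (z + w) - 0)).
  by move=> w2; apply: cdrvM; [exact: gbd|apply: cdrvV; [exact: dend|exact: den]].
have z00 : normc (0 : C) <= 1 / 2 by rewrite normc0; lra.
have S0 : S 0 = 0 by rewrite /S /g addr0 subrr mul0r.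
have dS0 : cderiv S 0 = (1 - b^*%C * b)^-1 * (s%:C%C * cderiv f z).
  by rewrite (cderiv_cdrv (Sd 0 z00)) /g addr0 subrr mul0r add0r subr0.
have Son : cdrv_on S (1 / 2) by move=> w w2; eexists; exact: Sd.
have S1 w : normc w <= 1 / 2 -> normc (S w) <= 1.
  move=> w2; rewrite normcM normcV ler_pdivrMr ?normc_gt0 ?den // mul1r.
  by apply: normc_mobius; [|have := gs w w2]; lra.
have := max_modulus (cdrv_dquot _ Son) (M := 2) (a := 0); rewrite normc0 dquot0 dS0.
have half0 : 0 < 1 / 2 :> R by rewrite divr_gt0.
move=> /(_ half0 half0) H.
have : normc ((1 - b^*%C * b)^-1 * (s%:C%C * cderiv f z)) <= 2.
  apply: H => w w2; have w0 : w != 0 by rewrite -normc_gt0 w2.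
  rewrite dquot_neq0 // S0 subr0 normcM normcV w2.
  by have := S1 w; rewrite w2 => /(_ (lexx _)); lra.
have -> : b^*%C * b = (s ^+ 2 * normc (f z) ^+ 2)%:C%C.
  rewrite -[b^*%C]/(conjc b) mulrC -sqr_normc normC_normc -rmorphXn /=; congr _%:C%C.
  by rewrite normcM normc_real exprMn real_normK ?num_real.
rewrite -[1]/((1 : R)%:C%C) -rmorphB normcM normcV !normcM !normc_real.
have s2 : s ^+ 2 * normc (f z) ^+ 2 < 1.
  by have := ler_wpM2l (sqr_ge0 s) fz2; rewrite mulr1 => ?; nra.
rewrite ger0_norm; last by lra.
rewrite ger0_norm; last by lra.
by rewrite ler_pdivrMl ?subr_gt0 // [leRHS]mulrC.
Qed.
End SchwarzPick.

(** * Functions with |P'| <= 1 in the unit disc *)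

Section UnitDerivative.
Variable R : realType.
Local Notation C := (R[i]).
Implicit Types (z w : C).
Variable P : C -> C.
Hypothesis Pd : cdrv_in_disc P.
Hypothesis P1 : forall z, normc z < 1 -> normc (cderiv P z) <= 1.

(** Rotates the ray through z to the positive axis, so that t |z| becomes the real part of a
    holomorphic function of t z. *)
Let ray z : C := (normc z)%:C%C / z.

Lemma rayK z : z != 0 -> ray z * z = (normc z)%:C%C.
Proof. by move=> z0; rewrite divfK. Qed.

Lemma normc_tZ (t : R) z : 0 <= t <= 1 -> normc (t%:C%C * z) = t * normc z.
Proof. by move=> /andP[t0 _]; rewrite normcM normc_real ger0_norm. Qed.

Lemma normc_tZ_le (t : R) z : 0 <= t <= 1 -> normc (t%:C%C * z) <= normc z.
Proof.
by move=> t01; rewrite normc_tZ // ler_piMl ?normc_ge0 //; case/andP: t01.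
Qed.

Lemma dist_origin_le z : normc z < 1 -> normc (P z - P 0) <= normc z.
Proof.
move=> z1; have [->|z0] := eqVneq z 0; first by rewrite subrr.
have [e [e1 eW]] := normc_phase (P z - P 0).
have /= := @Re_line_le _ (fun w => e * (P w - P 0) - ray z * w)
  (fun t => e * cderiv P (t%:C%C * z) - ray z) z.
rewrite eW rayK // subrr !mulr0 subrr -rmorphB /= subr_le0; apply=> t t01.
  have tz1 : normc (t%:C%C * z) < 1 by apply: le_lt_trans z1; exact: normc_tZ_le.
  have h1 := cdrvM (cdrv_cst e (t%:C%C * z)) (cdrvB (cdrv_in_discE Pd tz1) (cdrv_cst (P 0) _)).
  have h2 := cdrvM (cdrv_cst (ray z) (t%:C%C * z)) (cdrv_id (t%:C%C * z)).
  by apply: cdrv_eq (cdrvB h1 h2) _; ring.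
have tz1 : normc (t%:C%C * z) < 1 by apply: le_lt_trans z1; exact: normc_tZ_le.
rewrite mulrBr [z * ray z]mulrC rayK // ReD ReN subr_le0 /=.
apply: le_trans (Re_le_normc _) _; rewrite !normcM e1 mul1r ler_piMr ?normc_ge0 //.
exact: P1.
Qed.

(** The gap is (1 - x) ^ 2. The factor 1 / 2 will be the bound on |z|, and the rest comes from
    [schwarz_pick]. *)
Lemma half_1Bsqr_le (x : R) : 1 / 2 * (2 * (1 - x ^+ 2)) <= 2 * (1 - x).
Proof. by have := sqr_ge0 (1 - x); rewrite !expr2; lra. Qed.

(* Along the ray from 0 to z, the derivative of w P'(w) - (P w - P 0) has modulus
   |w P''(w)| <= 2 (1 - |P' w|), while |w| - |P w - P 0| grows at rate >= 1 - |P' w|. *)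
Lemma mul_cderiv_sub_dist_le z : normc z < 1 / 2 ->
  normc (z * cderiv P z - (P z - P 0)) <= 2 * (normc z - normc (P z - P 0)).
Proof.
move=> z12; have [->|z0] := eqVneq z 0.
  by rewrite mul0r !(subrr, normc0, mulr0).
have [e [e1 eW]] := normc_phase (P z - P 0).
have [c [c1 cX]] := normc_phase (z * cderiv P z - (P z - P 0)).
have P'd := cdrv_in_disc_cderiv Pd.
(* The phases [c] and [e] are fixed by the endpoint z: Re (Y z) is then exactly the difference of
   the two sides, while [Y] remains holomorphic in w. *)
pose Y w := c * (w * cderiv P w - (P w - P 0)) - 2%:C%C * (ray z * w - e * (P w - P 0)).
have Y0 : Y 0 = 0 by rewrite /Y; ring.
have Yz : complex.Re (Y z) = normc (z * cderiv P z - (P z - P 0)) -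
    2 * (normc z - normc (P z - P 0)).
  by rewrite /Y cX eW rayK // -!(rmorphB, rmorphM) /=.
rewrite -subr_le0 -Yz -[0]/(complex.Re (0 : C)) -Y0.
apply: (@Re_line_le _ _ (fun t => c * (t%:C%C * z * cderiv (cderiv P) (t%:C%C * z)) -
            2%:C%C * (ray z - e * cderiv P (t%:C%C * z)))) => t t01.
  have tz1 : normc (t%:C%C * z) < 1.
    by apply: le_lt_trans (normc_tZ_le _ t01) _; lra.
  have dP := cdrv_in_discE Pd tz1; have dP' := cdrv_in_discE P'd tz1.
  have dW := cdrvB dP (cdrv_cst (P 0) (t%:C%C * z)).
  have h1 := cdrvM (cdrv_cst c _) (cdrvB (cdrvM (cdrv_id _) dP') dW).
  have h2 := cdrvB (cdrvM (cdrv_cst (ray z) _) (cdrv_id (t%:C%C * z))) (cdrvM (cdrv_cst e _) dW).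
  have h3 := cdrvB h1 (cdrvM (cdrv_cst 2%:C%C _) h2).
  refine (cdrv_eq h3 _).
  move: (cderiv _ _) (cderiv _ _) => p q.
  by ring.
have tz : normc (t%:C%C * z) < 1 / 2 by apply: le_lt_trans z12; exact: normc_tZ_le.
have tz1 : normc (t%:C%C * z) < 1 by lra.
have := schwarz_pick P'd P1 tz.
move: (cderiv P _) (cderiv (cderiv P) _) => p q pq.
have -> : z * (c * (t%:C%C * z * q) - 2%:C%C * (ray z - e * p)) =
    z * c * (t%:C%C * z) * q - 2%:C%C * (ray z * z - z * e * p) by ring.
rewrite rayK // ReD ReN ReZ ReD ReN /=.
have b1 : complex.Re (z * c * (t%:C%C * z) * q) <= normc z * (2 * (1 - normc p)).
  apply: le_trans (Re_le_normc _) _; rewrite 3!normcM c1 mulr1 -mulrA.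
  rewrite ler_wpM2l ?normc_ge0 //.
  apply: le_trans (ler_pM (normc_ge0 _) (normc_ge0 _) (ltW tz) pq) _.
  exact: half_1Bsqr_le.
have b2 : complex.Re (z * e * p) <= normc z * normc p.
  by apply: le_trans (Re_le_normc _) _; rewrite !normcM e1 mulr1.
move: b1 b2; clear; lra.
Qed.

(** With u = v / N this says that 1 / (1 + u) maps |u| <= th into the disc of centre 1 / (1 - th ^
    2) and radius th / (1 - th ^ 2). The squares differ by (1 - th ^ 2) (th ^ 2 |N| ^ 2 - |v| ^
    2). *)
Lemma normc_diff_disc (N v : C) (th : R) : 0 <= th <= 1 -> normc v <= th * normc N ->
  normc ((th ^+ 2)%:C%C * N + v) <= th * normc (N + v).
Proof.
move=> /andP[th0 th1] vN.
suff : normc ((th ^+ 2)%:C%C * N + v) ^+ 2 <= (th * normc (N + v)) ^+ 2.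
  by rewrite ler_pXn2r // nnegrE ?mulr_ge0 ?normc_ge0.
rewrite exprMn !sqr_normcD normcM normc_real ger0_norm ?sqr_ge0 //.
have v2 : normc v ^+ 2 <= th ^+ 2 * normc N ^+ 2.
  by rewrite -exprMn; apply: lerXn2r; rewrite ?nnegrE ?mulr_ge0 ?normc_ge0.
have t2 : 0 <= 1 - th ^+ 2 by rewrite subr_ge0 exprn_ile1.
have := ler_wpM2l t2 v2.
have -> : complex.Im ((th ^+ 2)%:C%C * N) = th ^+ 2 * complex.Im N.
  by case: (N) => ? ? /=; rewrite mul0r addr0.
rewrite ReZ exprMn; move: (th ^+ 2) => s; lra.
Qed.

(* If |P 0| > 2, then on a circle |z| = r with |P 0| r > 1 + r ^ 2 the quotient
   (1 + P 0 z) / (1 + z P z) takes its values in a disc avoiding 0, although it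
   vanishes at -1 / P 0. *)
Lemma normc_origin_le2 : (forall z, normc z < 1 -> 1 + z * P z != 0) ->
  normc (P 0) <= 2.
Proof.
move=> h0; rewrite leNgt; apply/negP => A2.
set a := P 0 in A2 *; set A := normc a in A2.
have A0 : 0 < A by lra.
have a0 : a != 0 by rewrite -normc_gt0.
have V0 : 0 < A^-1 by rewrite invr_gt0.
have AV : A * A^-1 = 1 by rewrite divff // gt_eqF.
have V2 : A^-1 < 1 / 2 by nra.
pose r := (1 + 2 / A) / 2.
have r1 : r < 1 by rewrite /r; lra.
have rV : A^-1 < r by rewrite /r; lra.
have Ar : 1 + r ^+ 2 < A * r by rewrite /r expr2; nra.
have r0 : 0 <= r by lra.
have Ar1 : 0 < A * r - 1 by have := sqr_ge0 r; lra.
(* On |z| = r this bounds |v / N|, because |v| <= r ^ 2 and |N| >= A r - 1. *)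
pose th := r ^+ 2 / (A * r - 1).
have th0 : 0 <= th by rewrite divr_ge0 ?sqr_ge0 // ltW.
have th1 : th < 1 by rewrite ltr_pdivrMr //; lra.
have t2 : 0 < 1 - th ^+ 2 by rewrite subr_gt0 exprn_ilt1.
(* Centre of the disc from [normc_diff_disc]; its radius th c is smaller than c, so the value -c of
   [Y] at the zero of the numerator is excluded. *)
pose c := (1 - th ^+ 2)^-1.
have c0 : 0 < c by rewrite invr_gt0.
pose Y z := (1 + a * z) / (1 + z * P z) - c%:C%C.
have Yon : cdrv_on Y r.
  move=> z zr; have z1 : normc z < 1 by lra.
  have [l Pl] := Pd z1; eexists.
  apply: cdrvB; last exact: cdrv_cst.
  apply: cdrvM.
    apply: cdrvD; first exact: cdrv_cst.
    by apply: cdrvM; [exact: cdrv_cst|exact: cdrv_id].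
  apply: cdrvV; last exact: h0.
  apply: cdrvD; first exact: cdrv_cst.
  by apply: cdrvM; [exact: cdrv_id|exact: Pl].
have Ycirc z : normc z = r -> normc (Y z) <= th * c.
  move=> zr; have z1 : normc z < 1 by lra.
  set N := 1 + a * z; set v := z * (P z - a).
  have D : 1 + z * P z = N + v by rewrite /N /v; ring.
  have N0 : A * r - 1 <= normc N.
    by have := ler_distc (a * z) (-1); rewrite opprK normcN normc1 normcM zr /N [1 + _]addrC.
  have vN : normc v <= th * normc N.
    apply: (@le_trans _ _ (th * (A * r - 1))); last by rewrite ler_wpM2l.
    rewrite divfK ?gt_eqF // normcM zr expr2 ler_wpM2l //.
    by rewrite -[leRHS]zr; exact: dist_origin_le.
  have Nv : N + v != 0 by rewrite -D h0.
  have c0' : (1 - th ^+ 2)%:C%C != 0 :> C by rewrite fmorph_eq0 gt_eqF.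
  have -> : Y z = - ((th ^+ 2)%:C%C * N + v) / (N + v) * c%:C%C.
    rewrite /Y D -/N (_ : c%:C%C = (1 - (th ^+ 2)%:C%C)^-1); last first.
      by rewrite /c fmorphV rmorphB.
    have : 1 - (th ^+ 2)%:C%C != 0 :> C by rewrite -[1]/(1%:C%C) -rmorphB.
    by move: (th ^+ 2)%:C%C N v Nv {D N0 vN} => T N v Nv T1; field; rewrite Nv T1.
  rewrite normcM normc_real gtr0_norm // ler_pM2r // normcM normcN normcV.
  by rewrite ler_pdivrMr ?normc_gt0 // normc_diff_disc // th0 ltW.
have nV : normc (- a^-1) < r by rewrite normcN normcV.
have := max_modulus Yon nV Ycirc.
have -> : Y (- a^-1) = - c%:C%C by rewrite /Y mulrN divff // subrr mul0r sub0r.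
rewrite normcN normc_real gtr0_norm // leNgt => /negP; apply.
by rewrite gtr_pMl.
Qed.
End UnitDerivative.

(** * The class U *)

Section ClassU.
Variable R : realType.
Local Notation C := (R[i]).
Implicit Types (f : C -> C) (z w : C).

Lemma normC_lt z (x : R) : (`|z| < x%:C%C) = (normc z < x).
Proof. by rewrite normC_normc ltcR. Qed.

Lemma normC_lt1 z : (`|z| < 1) = (normc z < 1).
Proof. by rewrite -normC_lt. Qed.

Lemma normC_half z : `|z| / 2 = (normc z / 2)%:C%C.
Proof. by rewrite normC_normc rmorphM fmorphV rmorph_nat. Qed.

(* P' is, up to sign, the quotient of (z / f(z))^2 f'(z) - 1 by z^2. *)
Lemma classU_repr f : classU f -> exists P : C -> C,
  [/\ cdrv_in_disc P, (forall z, normc z < 1 -> normc (cderiv P z) <= 1),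
      P 0 = - a2 f, (forall z, normc z < 1 -> 1 + z * P z != 0) &
      (forall z, normc z < 1 -> z != 0 -> z / f z = 1 + z * P z)].
Proof.
move=> [[fan f0 f'0] fneq0 fU].
have fd : cdrv_in_disc f by move=> z; rewrite -normC_lt1 => /fan /cderivableP.
(* These are f(z) / z, z / f(z) and (z / f(z) - 1) / z, defined at 0 as well. *)
pose k := dquot f; pose h z := (k z)^-1; pose P := dquot h.
have kd : cdrv_in_disc k := cdrv_in_disc_dquot fd.
have k'd := cdrv_in_disc_cderiv kd.
have k0 : k 0 = 1 by rewrite /k dquot0.
have fE : f = fun z => z * k z by apply/funext => z; rewrite {1}(dquotE f) f0 add0r.
have kneq0 z : normc z < 1 -> k z != 0.
  move=> z1; have [->|z0] := eqVneq z 0; first by rewrite k0 oner_neq0.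
  by have := fneq0 z; rewrite normC_lt1 => /(_ z1 z0); rewrite {1}fE mulf_eq0 (negPf z0).
have dk z : normc z < 1 -> cdrv k z (cderiv k z) by exact: cdrv_in_discE.
have dh z : normc z < 1 -> cdrv h z (- cderiv k z / k z ^+ 2).
  by move=> z1; apply: cdrvV; [exact: dk|exact: kneq0].
have hd : cdrv_in_disc h by move=> z z1; eexists; exact: dh.
have h0 : h 0 = 1 by rewrite /h k0 invr1.
have hE z : h z = 1 + z * P z by rewrite (dquotE h) h0.
have Pd : cdrv_in_disc P := cdrv_in_disc_dquot hd.
have P'd := cdrv_in_disc_cderiv Pd.
have df z : normc z < 1 -> cderiv f z = z * cderiv k z + k z.
  move=> z1; rewrite -[in LHS]/(cderiv f z) {1}fE.
  by rewrite (cderiv_cdrv (cdrvM (cdrv_id z) (dk z z1))) mulr1.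
have normc00 : normc (0 : C) < 1 by rewrite normc0.
have a2E : a2 f = cderiv k 0.
  rewrite /a2; have d1 := cdrvD (cdrvM (cdrv_id 0) (cdrv_in_discE k'd normc00)) (dk 0 normc00).
  have d2 : cdrv (cderiv f) 0 (0 * cderiv (cderiv k) 0 + cderiv k 0 * 1 + cderiv k 0).
    apply: (cdrv_near ltr01 _ d1) => z; rewrite subr0 => z1; exact/esym/df.
  by rewrite (cderiv_cdrv d2); move: (cderiv k 0) (cderiv (cderiv k) 0) => u v; field.
exists P; split => //.
(* On |z| = r the defining inequality of the class reads r ^ 2 |P'| <= 1; the maximum principle
   carries it to a, and r tends to 1. *)
- move=> a a1; apply: (@le1_lim_scale _ _ (normc a)); rewrite ?normc_ge0 //= => r /andP[ar r1].
  have r0 : 0 < r by apply: le_lt_trans ar; exact: normc_ge0.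
  have r20 : 0 < r ^+ 2 by rewrite exprn_gt0.
  rewrite mulrC -ler_pdivlMr // mul1r.
  apply: (max_modulus (cdrv_in_disc_on P'd r1) ar) => z zr.
  have z1 : normc z < 1 by rewrite zr.
  have z0 : z != 0 by rewrite -normc_gt0 zr.
  have := fU z; rewrite !normC_lt1 => /(_ z1 z0) /ltW.
  have kz := kneq0 z z1.
  (* Both sides are the derivative of h, computed from 1 / k and from 1 + z P. *)
  have h'E : - cderiv k z / k z ^+ 2 = z * cderiv P z + P z.
    have e1 := cdrvD (cdrv_cst 1 z) (cdrvM (cdrv_id z) (cdrv_in_discE Pd z1)).
    have e2 : cdrv h z (0 + (z * cderiv P z + P z * 1)).
      by apply: (cdrv_near ltr01 _ e1) => w _; rewrite hE.
    by rewrite (cdrv_unique (dh z z1) e2) add0r mulr1.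
  suff -> : (z / f z) ^+ 2 * cderiv f z - 1 = - (z ^+ 2 * cderiv P z).
    by rewrite normcN normcM normcX zr mulrC -ler_pdivlMr // mul1r.
  have : (k z)^-1 = 1 + z * P z by rewrite -hE.
  rewrite df // fE; move: h'E; move: (cderiv k z) (cderiv P z) (P z) (k z) kz.
  move=> k' P' p u u0 E1 E2.
  have -> : (z / (z * u)) ^+ 2 * (z * k' + u) - 1 = u^-1 - 1 - z * (- k' / u ^+ 2).
    by field; rewrite u0 z0.
  by rewrite E1 E2; ring.
- by rewrite /P dquot0 (cderiv_cdrv (dh 0 normc00)) k0 expr1n divr1 a2E.
- by move=> z z1; rewrite -hE invr_neq0 // kneq0.
- by move=> z z1 z0; rewrite -hE fE invfM mulVKf.
Qed.

(** With A = |a| and w = |W|, (A - w) ^ 2 - 2 A (r - w) - w ^ 2 = A (A - 2 r): the terms in w cancel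
    and exactly r < A / 2 remains. *)
Lemma normc_quotient_lt (a W v : C) (r : R) : normc W <= r -> r < normc a / 2 ->
  normc (v - W) <= 2 * (r - normc W) ->
  normc (a * (v - W) - W ^+ 2) < normc (a + W) ^+ 2.
Proof.
move=> Wr ra vW; have W0 := normc_ge0 W; set A := normc a in ra *.
have aW : A - normc W <= normc (a + W).
  by have := ler_distc a (- W); rewrite normcN opprK.
have A0 : 0 < A by lra.
apply: (@le_lt_trans _ _ (A * (2 * (r - normc W)) + normc W ^+ 2)).
  apply: le_trans (normcB _ _) _; rewrite normcM normcX lerD2r.
  by rewrite ler_wpM2l // ltW.
apply: (@lt_le_trans _ _ ((A - normc W) ^+ 2)); last first.
  by apply: lerXn2r; rewrite ?nnegrE ?normc_ge0 //; lra.
have : 0 < A * (A - 2 * r) by rewrite mulr_gt0 //; lra.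
rewrite !expr2; lra.
Qed.

(** * The three estimates for g in terms of P *)

Section Representation.
Variables (f P : C -> C).
Hypothesis a0 : a2 f != 0.
Hypothesis Pd : cdrv_in_disc P.
Hypothesis P'1 : forall z, normc z < 1 -> normc (cderiv P z) <= 1.
Hypothesis P0 : P 0 = - a2 f.
Hypothesis Pneq0 : forall z, normc z < 1 -> 1 + z * P z != 0.
Hypothesis PE : forall z, normc z < 1 -> z != 0 -> z / f z = 1 + z * P z.

Let a := P 0.

Lemma P_origin_neq0 : a != 0.
Proof. by rewrite /a P0 oppr_eq0. Qed.

Lemma gfunE z : normc z < 1 -> gfun f z = z * P z / a.
Proof.
move=> z1; rewrite /gfun; have [->|z0] := eqVneq z 0; first by rewrite !mul0r.
by rewrite PE // /a P0 [1 + _]addrC addrK.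
Qed.

Lemma cdrv_gfun z : normc z < 1 -> cdrv (gfun f) z ((P z + z * cderiv P z) / a).
Proof.
move=> z1; have z10 : 0 < 1 - normc z by rewrite subr_gt0.
have d1 := cdrvM (cdrvM (cdrv_id z) (cdrv_in_discE Pd z1)) (cdrv_cst a^-1 z).
have /cdrv_eq : cdrv (gfun f) z (z * P z * 0 + a^-1 * (z * cderiv P z + P z * 1)).
  apply: (cdrv_near z10 _ d1) => w wz; rewrite gfunE //.
  by have := ler_distc w z; lra.
by apply; rewrite mulr0 add0r mulr1 mulrC [P z + _]addrC.
Qed.

Lemma normc_a2 : `|a2 f| = `|a|.
Proof. by rewrite /a P0 normrN. Qed.

Lemma a2_disc z : `|z| < `|a2 f| / 2 ->
  [/\ normc z < 1, normc z < normc a / 2 & normc (P z - a) <= normc z].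
Proof.
rewrite normc_a2 normC_half normC_lt => za.
have z1 : normc z < 1.
  by apply: lt_le_trans za _; have := normc_origin_le2 Pd P'1 Pneq0; rewrite -/a; lra.
by split => //; exact: dist_origin_le.
Qed.

(** From |P z| >= |a| - |z| > 2 |z| - |z|. It keeps g from vanishing for z != 0 and is precisely
    what (b) needs, as z g' / g - 1 = z P' / P. *)
Lemma a2_disc_P_neq0 z : `|z| < `|a2 f| / 2 -> normc z < normc (P z).
Proof.
move=> /a2_disc[z1 za Wz]; have := ler_distc a (P z); rewrite normc_sym.
have := normc_ge0 z; lra.
Qed.

Lemma gfun_part_a z : `|z| < `|a2 f| / 2 -> `|cderiv (gfun f) z - 1| < 1.
Proof.
move=> zd; have [z1 za Wz] := a2_disc zd; have an0 := P_origin_neq0.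
rewrite normC_lt1 (cderiv_cdrv (cdrv_gfun z1)).
have -> : (P z + z * cderiv P z) / a - 1 = (P z - a + z * cderiv P z) / a by field.
rewrite normcM normcV ltr_pdivrMr ?normc_gt0 // mul1r.
apply: le_lt_trans (le_normcD _ _) _; rewrite normcM.
have := ler_wpM2l (normc_ge0 z) (P'1 z1); lra.
Qed.

Lemma gfun_part_b z : z != 0 -> `|z| < `|a2 f| / 2 ->
  `|z * cderiv (gfun f) z / gfun f z - 1| < 1 /\
  0 < complex.Re (z * cderiv (gfun f) z / gfun f z).
Proof.
move=> z0 zd; have [z1 za Wz] := a2_disc zd; have an0 := P_origin_neq0.
have zP := a2_disc_P_neq0 zd.
have Pz0 : P z != 0 by rewrite -normc_gt0; exact: le_lt_trans (normc_ge0 z) zP.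
rewrite normC_lt1 (cderiv_cdrv (cdrv_gfun z1)) gfunE //.
set u := _ / _.
have uE : u - 1 = z * cderiv P z / P z by rewrite /u; field; rewrite Pz0 an0 z0.
have u1 : normc (u - 1) < 1.
  rewrite uE normcM normcV ltr_pdivrMr ?normc_gt0 // mul1r normcM.
  by apply: le_lt_trans zP; rewrite ler_piMr ?normc_ge0 // P'1.
split => //; have := Re_le_normc (1 - u); rewrite normc_sym ReD ReN /=; lra.
Qed.

Lemma gfun_part_c z : `|a2 f| <= 1 -> z != 0 -> `|z| < `|a2 f| / 2 ->
  `|(z / gfun f z) ^+ 2 * cderiv (gfun f) z - 1| < 1.
Proof.
move=> a1 z0 zd; have {}a1 : normc a <= 1 by rewrite -lecR; move: a1; rewrite normc_a2.
have [z1 za Wz] := a2_disc zd; have an0 := P_origin_neq0.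
have zP := a2_disc_P_neq0 zd.
have Pz0 : P z != 0 by rewrite -normc_gt0; exact: le_lt_trans (normc_ge0 z) zP.
rewrite normC_lt1 (cderiv_cdrv (cdrv_gfun z1)) gfunE //.
(* The assumption |a_2| <= 1 enters here, placing z where [mul_cderiv_sub_dist_le] applies. *)
have z12 : normc z < 1 / 2 by lra.
have -> : (z / (z * P z / a)) ^+ 2 * ((P z + z * cderiv P z) / a) - 1 =
    (a * (z * cderiv P z - (P z - a)) - (P z - a) ^+ 2) / P z ^+ 2.
  move: (cderiv P z) (P z) a Pz0 an0 => P' p b p0 b0.
  by field; rewrite p0 b0 z0.
rewrite normcM normcV normcX ltr_pdivrMr ?mul1r; last by rewrite exprn_gt0 ?normc_gt0.
rewrite -[X in normc X ^+ 2](subrK a) [P z - a + a]addrC.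
by apply: normc_quotient_lt za _ => //; exact: mul_cderiv_sub_dist_le.
Qed.

Lemma gfun_normalized : `|a2 f| <= 1 ->
  [/\ analytic_in_disc (`|a2 f| / 2) (gfun f), gfun f 0 = 0 & cderiv (gfun f) 0 = 1].
Proof.
move=> a1; split.
- by move=> z /a2_disc[z1 _ _]; apply/cderivableP; eexists; exact: cdrv_gfun.
- by rewrite /gfun eqxx.
rewrite (cderiv_cdrv (cdrv_gfun _)) ?normc0 // mul0r addr0 divff //.
exact: P_origin_neq0.
Qed.
End Representation.
End ClassU.

(** * The extremal function *)

Section Extremal.
Variable R : realType.
Local Notation C := (R[i]).
Implicit Types (z w : C).

(** Here P z = z - 1, so P' = 1 and |P z - P 0| = |z|: the basic bounds on P' and W hold with
    equality. *)
Definition extremal z : C := z / (1 - z + z ^+ 2).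

Lemma extremal_den_neq0 z : normc z < 1 -> 1 - z + z ^+ 2 != 0.
Proof.
move=> z1; apply/eqP => Q0.
have z3 : z ^+ 3 = -1.
  have : (z + 1) * (1 - z + z ^+ 2) = z ^+ 3 + 1 by ring.
  by rewrite Q0 mulr0 => /eqP; rewrite eq_sym addr_eq0 => /eqP.
have : normc z ^+ 3 = 1 by rewrite -normcX z3 normcN normc1.
by apply/eqP; rewrite lt_eqF // exprn_ilt1 ?normc_ge0.
Qed.

Lemma cdrv_den z : cdrv (fun z : C => 1 - z + z ^+ 2) z (2 * z - 1).
Proof.
have := cdrvD (cdrvB (cdrv_cst 1 z) (cdrv_id z)) (cdrvX 2 (cdrv_id z)).
by move=> /cdrv_eq; apply; rewrite /= expr1; ring.
Qed.

Lemma cdrv_extremal z : normc z < 1 ->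
  cdrv extremal z ((1 - z ^+ 2) / (1 - z + z ^+ 2) ^+ 2).
Proof.
move=> z1; have Q0 := extremal_den_neq0 z1.
have := cdrvM (cdrv_id z) (cdrvV (cdrv_den z) Q0).
by move=> /cdrv_eq; apply; field.
Qed.

Lemma cderiv_extremal z : normc z < 1 ->
  cderiv extremal z = (1 - z ^+ 2) / (1 - z + z ^+ 2) ^+ 2.
Proof. by move=> /cdrv_extremal /cderiv_cdrv. Qed.

Let normc00 : normc (0 : C) < 1.
Proof. by rewrite normc0. Qed.

Lemma a2_extremal : a2 extremal = 1.
Proof.
suff d : cdrv (cderiv extremal) 0 2 by rewrite /a2 (cderiv_cdrv d) divff.
have Q0 : (1 - (0 : C) + 0 ^+ 2) ^+ 2 != 0.
  by rewrite expf_neq0 // extremal_den_neq0.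
have d1 := cdrvM (cdrvB (cdrv_cst 1 0) (cdrvX 2 (cdrv_id (0 : C))))
                 (cdrvV (cdrvX 2 (cdrv_den 0)) Q0).
apply: (cdrv_near ltr01 (f := fun z => (1 - z ^+ 2) / (1 - z + z ^+ 2) ^+ 2)).
  by move=> z; rewrite subr0 => z1; rewrite cderiv_extremal.
by apply: cdrv_eq d1 _; rewrite /= subr0 expr0n /= addr0 !expr1n; field.
Qed.

Lemma gfun_extremal z : normc z < 1 -> gfun extremal z = z - z ^+ 2.
Proof.
move=> z1; rewrite /gfun a2_extremal; have [->|z0] := eqVneq z 0.
  by rewrite expr0n subr0.
by have Q0 := extremal_den_neq0 z1; rewrite /extremal; field; rewrite Q0 z0.
Qed.

Lemma classU_extremal : classU extremal.
Proof.
split; [split| |].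
- by move=> z; rewrite normC_lt1 => z1; apply/cderivableP; eexists; exact: cdrv_extremal.
- by rewrite /extremal mul0r.
- by rewrite cderiv_extremal // expr0n /= !subr0 addr0 expr1n divr1.
- move=> z; rewrite normC_lt1 => z1 z0.
  by rewrite mulf_neq0 // invr_neq0 // extremal_den_neq0.
move=> z; rewrite !normC_lt1 => z1 z0; have Q0 := extremal_den_neq0 z1.
rewrite cderiv_extremal // /extremal.
rewrite (_ : _ - 1 = - z ^+ 2); last by field; rewrite Q0 z0.
by rewrite normcN normcX exprn_ilt1 ?normc_ge0.
Qed.

Lemma cderiv_gfun_extremal_half : cderiv (gfun extremal) (1 / 2) = 0.
Proof.
have half1 : normc (1 / 2 : C) = 1 / 2.
  rewrite -[2]/(2%:R) -(rmorph_nat (real_complex R)) -[1]/((1 : R)%:C%C).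
  by rewrite -fmorphV -rmorphM normc_real ger0_norm.
suff : cdrv (gfun extremal) (1 / 2) 0 by move/cderiv_cdrv.
have half0 : 0 < 1 / 2 :> R by rewrite divr_gt0.
apply: (cdrv_near half0 (f := fun z => z - z ^+ 2)).
  by move=> z zh; rewrite gfun_extremal //; have := ler_distc z (1 / 2); rewrite half1; lra.
have := cdrvB (cdrv_id (1 / 2 : C)) (cdrvX 2 (cdrv_id (1 / 2 : C))).
by move=> /cdrv_eq; apply; rewrite /= expr1; field.
Qed.
End Extremal.

Theorem theorem4 :
  (forall (R : realType) (f : R[i] -> R[i]),
    classU f -> a2 f != 0 ->
    (* (a) *)
    (forall z : R[i], `|z| < `|a2 f| / 2 -> `|cderiv (gfun f) z - 1| < 1) /\
    (* (b) and the starlikeness consequence *)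
    (forall z : R[i], z != 0 -> `|z| < `|a2 f| / 2 ->
        `|z * cderiv (gfun f) z / gfun f z - 1| < 1 /\
        0 < complex.Re (z * cderiv (gfun f) z / gfun f z)) /\
    (* (c) *)
    (`|a2 f| <= 1 ->
        [/\ analytic_in_disc (`|a2 f| / 2) (gfun f),
            gfun f 0 = 0, cderiv (gfun f) 0 = 1 &
            forall z : R[i], z != 0 -> `|z| < `|a2 f| / 2 ->
              `|(z / gfun f z) ^+ 2 * cderiv (gfun f) z - 1| < 1])) /\
  (* sharpness: the radius |a_2|/2 cannot be enlarged in (a), (b), (c) *)
  (forall R : realType, exists f : R[i] -> R[i],
    [/\ classU f, a2 f != 0, `|a2 f| <= 1 &
      forall r : R[i], `|a2 f| / 2 < r ->
        exists z : R[i], [/\ `|z| < r, `|z| < 1, z != 0 &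
          [/\ ~ (`|cderiv (gfun f) z - 1| < 1),
          ~ (`|z * cderiv (gfun f) z / gfun f z - 1| < 1) &
          ~ (`|(z / gfun f z) ^+ 2 * cderiv (gfun f) z - 1| < 1)]]]).
Proof.
split=> [R f fU a0|R].
  have [P [Pd P'1 P0 Pneq0 PE]] := classU_repr fU.
  split; first by move=> z; exact: gfun_part_a Pd P'1 P0 Pneq0 PE z.
  split; first by move=> z; exact: gfun_part_b Pd P'1 P0 Pneq0 PE z.
  move=> a1; have [g1 g2 g3] := gfun_normalized a0 Pd P'1 P0 Pneq0 PE a1.
  by split => // z; exact: gfun_part_c Pd P'1 P0 Pneq0 PE z a1.
exists (@extremal R); rewrite a2_extremal; split.
- exact: classU_extremal.
- exact: oner_neq0.
- by rewrite normr1.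
(* The point 1 / 2 = |a_2| / 2 is a critical point of g, so each of the three quantities reduces to
   |0 - 1| = 1. *)
move=> r; rewrite normr1 => r12; exists (1 / 2).
have half : `|1 / 2 : R[i]| = 1 / 2 by rewrite ger0_norm // divr_ge0.
rewrite cderiv_gfun_extremal_half half; split => //.
- by rewrite ltr_pdivrMr // mul1r ltrDl ltr01.
by rewrite !mulr0 mul0r sub0r normrN normr1 ltxx; split.
Qed.
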